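(* Let $\epsilon,\lambda,\tau,d_1,d_2>0$ and let $(u^n,v^n,p^n)_{n\ge 0}$ be generated on $\mathbb{R}^d$ by the semi-discrete semi-implicit scheme described in the context, starting from initial data $(u^0,v^0,p^0)$ satisfying $$0\le u^0(x)\le \|u^0\|_{L^\infty(\mathbb{R}^d)}<\infty,\qquad 0\le v^0(x)\le \|v^0\|_{L^\infty(\mathbb{R}^d)}<\infty,\qquad 0\le p^0(x)\le 1,$$ and $u^0,v^0\in L^2(\mathbb{R}^d)$. Then $u^n$ and $v^n$ are $L^2$ stable: for all $n\ge 0$, $u^n,v^n\in L^2(\mathbb{R}^d)$ and $$\|u^{n+1}\|_{L^2(\mathbb{R}^d)}\le\|u^n\|_{L^2(\mathbb{R}^d)},\qquad \|v^{n+1}\|_{L^2(\mathbb{R}^d)}\le\|v^n\|_{L^2(\mathbb{R}^d)} .$$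
   Context: The scheme discretizes in time (step size $\tau>0$) the fast reaction--diffusion system $$\partial_t u-d_1\Delta u=-\tfrac1\epsilon u[v+\lambda(1-p)],\quad \partial_t v-d_2\Delta v=-\tfrac1\epsilon v(u+\lambda p),\quad \partial_t p=\tfrac1\epsilon[(1-p)u-vp],\quad x\in\mathbb{R}^d,\ t>0.$$ The semi-discrete semi-implicit scheme is: given $(u^n,v^n,p^n)$, find successively $p^{n+1}$, $u^{n+1}$, $v^{n+1}$ such that $$\frac{p^{n+1}-p^n}{\tau}=\frac1\epsilon\left[(1-p^{n+1})u^n-v^np^{n+1}\right],$$ $$\frac{u^{n+1}-u^n}{\tau}-d_1\Delta u^{n+1}=-\frac1\epsilon u^{n+1}\left[v^n+\lambda(1-p^{n+1})\right],$$ $$\frac{v^{n+1}-v^n}{\tau}-d_2\Delta v^{n+1}=-\frac1\epsilon v^{n+1}\left(u^{n+1}+\lambda p^{n+1}\right).$$ Here $u^n,v^n,p^n$ are bounded measurable real-valued functions on $\mathbb{R}^d$; the two elliptic equations are understood in the sense of distributions, with $u^{n+1},v^{n+1}$ the bounded solutions. *)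

(* Defs.v *)
From HB Require Import structures.
From mathcomp Require Import all_boot all_order all_algebra.
From mathcomp Require Import all_classical all_reals all_analysis.

Set Implicit Arguments.
Unset Strict Implicit.
Unset Printing Implicit Defensive.
Import Order.TTheory GRing.Theory Num.Theory.
Import numFieldNormedType.Exports.

Local Open Scope classical_set_scope.
Local Open Scope ring_scope.

(* 'rV[T]_n carries the sigma-algebra generated by its coordinates; for
   T = R this is the Borel sigma-algebra of R^n. *)
Definition measure_rV_display : measure_display -> measure_display.
Proof. exact. Qed.

Section measurable_rV.
Context {disp : measure_display} {T : measurableType disp} {n : nat}.

Let coord_rV : 'I_n -> 'rV[T]_n -> T := fun i x => x ord0 i.

Let rV_set0 : g_sigma_preimage coord_rV set0.
Proof. exact: sigma_algebra0. Qed.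

Let rV_setC A : g_sigma_preimage coord_rV A -> g_sigma_preimage coord_rV (~` A).
Proof. exact: sigma_algebraC. Qed.

Let rV_bigcup (F : _^nat) : (forall i, g_sigma_preimage coord_rV (F i)) ->
  g_sigma_preimage coord_rV (\bigcup_i (F i)).
Proof. exact: sigma_algebra_bigcup. Qed.

HB.instance Definition _ := @isMeasurable.Build (measure_rV_display disp)
  'rV[T]_n (g_sigma_preimage coord_rV) rV_set0 rV_setC rV_bigcup.

Lemma measurable_coord_rV (i : 'I_n) :
  measurable_fun [set: 'rV[T]_n] (fun x : 'rV[T]_n => x ord0 i).
Proof.
move=> _ Y mY; rewrite setTI; apply: sub_sigma_algebra => /=.
rewrite -bigcup_seq/=; exists i => /=; first by rewrite mem_index_enum.
by exists Y => //; rewrite setTI.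
Qed.

Lemma measurable_fun_rVP d' (S : measurableType d') (f : S -> 'rV[T]_n) :
  (forall i, measurable_fun [set: S] (fun x => f x ord0 i)) ->
  measurable_fun [set: S] f.
Proof.
move=> mf _ A mA; rewrite setTI.
apply: (mA [set B | measurable (f @^-1` B)]); split.
  split => /=.
  - by rewrite preimage_set0.
  - by move=> B mB; rewrite setTD preimage_setC; exact: measurableC.
  - by move=> F mF; rewrite preimage_bigcup; exact: bigcupT_measurable.
move=> B; rewrite -bigcup_seq => -[i _ [C mC <-]] /=.
by rewrite setTI; have := mf i measurableT C mC; rewrite setTI.
Qed.

End measurable_rV.

Definition rV_cons {T : Type} {n : nat} (x : T * 'rV[T]_n) : 'rV[T]_n.+1 :=
  row_mx (const_mx x.1 : 'rV[T]_1) x.2.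

Section rV_cons_lemmas.
Context {disp : measure_display} {T : measurableType disp} {n : nat}.

Lemma rV_cons0 (x : T * 'rV[T]_n) : rV_cons x ord0 ord0 = x.1.
Proof.
by rewrite mxE; case: splitP => [j _|k //]; rewrite mxE.
Qed.

Lemma rV_consS (x : T * 'rV[T]_n) i : rV_cons x ord0 (lift ord0 i) = x.2 ord0 i.
Proof.
rewrite mxE; case: splitP => [[[]]//|k /= ik]; congr (x.2 _ _).
by apply/val_inj; move: ik; rewrite /bump /= !add1n => -[].
Qed.

Lemma measurable_rV_cons : measurable_fun [set: T * 'rV[T]_n] rV_cons.
Proof.
apply: measurable_fun_rVP => i; case: (unliftP ord0 i) => [j|] ->.
  rewrite (_ : (fun _ => _) = (fun y : 'rV[T]_n => y ord0 j) \o snd).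
    by apply: measurableT_comp => //; exact: measurable_coord_rV.
  by apply/funext => x /=; rewrite rV_consS.
rewrite (_ : (fun _ => _) = fst) //.
by apply/funext => x /=; rewrite rV_cons0.
Qed.

Lemma measurable_fun_rV_uncons :
  measurable_fun [set: 'rV[T]_n.+1]
    (fun y : 'rV[T]_n.+1 => (y ord0 ord0, \row_i y ord0 (lift ord0 i))).
Proof.
apply/measurable_fun_pair; first exact: measurable_coord_rV.
apply: measurable_fun_rVP => i.
rewrite (_ : (fun _ => _) = (fun y : 'rV[T]_n.+1 => y ord0 (lift ord0 i))).
  exact: measurable_coord_rV.
by apply/funext => y; rewrite mxE.
Qed.

End rV_cons_lemmas.

Lemma sigma_finite_prod d1 d2 (T1 : measurableType d1) (T2 : measurableType d2)
  (R : realType) (m1 : {sigma_finite_measure set T1 -> \bar R})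
  (m2 : {sigma_finite_measure set T2 -> \bar R}) :
  sigma_finite setT (m1 \x m2)%E.
Proof.
have /sigma_finiteP[F [TF ndF Foo]] := sigma_finiteT m1.
have /sigma_finiteP[G [TG ndG Goo]] := sigma_finiteT m2.
exists (fun n => F n `*` G n).
  rewrite -setXTT TF TG predeqE => -[x y]; split.
    move=> [/= [n _ Fnx] [k _ Gky]]; exists (maxn n k) => //; split.
    - by move: x Fnx; exact/subsetPset/ndF/leq_maxl.
    - by move: y Gky; exact/subsetPset/ndG/leq_maxr.
  by move=> [n _ []/= ? ?]; split; exists n.
move=> k; have [? ?] := Foo k; have [? ?] := Goo k.
split; first exact: measurableX.
by rewrite product_measure1E// lte_mul_pinfty// ge0_fin_numE.
Qed.

Section lebesgue_rV.
Context {R : realType}.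

Section cons.
Context {n : nat} (nu : {sigma_finite_measure set 'rV[R]_n -> \bar R}).
Local Notation prod := (@lebesgue_measure R \x nu)%E.

Definition measure_rV_cons : set 'rV[R]_n.+1 -> \bar R :=
  pushforward prod rV_cons.

Let rV_cons_measure0 : measure_rV_cons set0 = 0%E.
Proof. by rewrite /measure_rV_cons /pushforward preimage_set0 measure0. Qed.

Let rV_cons_measure_ge0 A : (0 <= measure_rV_cons A)%E.
Proof. exact: (measure_ge0 prod). Qed.

Let rV_cons_measure_sigma_additive : semi_sigma_additive measure_rV_cons.
Proof.
move=> F mF tF mUF; rewrite /measure_rV_cons /pushforward preimage_bigcup.
have mpre B : measurable B -> measurable (@rV_cons R n @^-1` B).
  by move=> mB; rewrite -[X in measurable X]setTI; exact: measurable_rV_cons.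
apply: measure_semi_sigma_additive.
- by move=> k; exact: mpre.
- apply/trivIsetP => /= i j _ _ ij; rewrite -preimage_setI.
  by move/trivIsetP : tF => /(_ _ _ _ _ ij) ->//; rewrite preimage_set0.
- by rewrite -preimage_bigcup; exact: mpre.
Qed.

HB.instance Definition _ := isMeasure.Build _ _ _ measure_rV_cons
  rV_cons_measure0 rV_cons_measure_ge0 rV_cons_measure_sigma_additive.

Let rV_cons_sigma_finite : sigma_finite setT measure_rV_cons.
Proof.
have [F TF Foo] := sigma_finite_prod (@lebesgue_measure R) nu.
pose h (y : 'rV[R]_n.+1) := (y ord0 ord0, \row_i y ord0 (lift ord0 i)).
have hK : cancel rV_cons h.
  move=> [x y]; rewrite /h rV_cons0; congr pair.
  by apply/rowP => i; rewrite mxE rV_consS.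
exists (fun k => h @^-1` F k) => [|k].
  by rewrite -preimage_bigcup -TF preimage_setT.
have [mF Fk] := Foo k; split.
  by rewrite -[X in measurable X]setTI; exact: measurable_fun_rV_uncons.
rewrite /measure_rV_cons /pushforward -comp_preimage.
by rewrite (_ : _ \o _ = id) ?preimage_id//; apply/funext => x /=; rewrite hK.
Qed.

HB.instance Definition _ :=
  Measure_isSigmaFinite.Build _ _ _ measure_rV_cons rV_cons_sigma_finite.

End cons.

(* Built along R^(n+1) = R * R^n; lebesgue_rV_box is the characterization by
   products of one-dimensional measures. *)
Fixpoint lebesgue_rV (n : nat) : {sigma_finite_measure set 'rV[R]_n -> \bar R} :=
  match n with
  | 0 => \d_(0 : 'rV[R]_0)
  | n'.+1 => measure_rV_cons (lebesgue_rV n')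
  end.

Lemma lebesgue_rV_box n (A : 'I_n -> set R) : (forall i, measurable (A i)) ->
  lebesgue_rV n [set x | forall i, A i (x ord0 i)] =
  (\prod_(i < n) lebesgue_measure (A i))%E.
Proof.
elim: n A => [|n IH] A mA /=.
  rewrite big_ord0 diracE mem_set//= => -[]//.
rewrite big_ord_recl -IH; last by move=> i; exact: mA.
have mB : measurable [set x : 'rV[R]_n | forall i, A (lift ord0 i) (x ord0 i)].
  rewrite [X in measurable X](_ : _ = \bigcap_(i in [set: 'I_n])
      ((fun x : 'rV[R]_n => x ord0 i) @^-1` A (lift ord0 i))).
    apply: fin_bigcap_measurable => // i _.
    by rewrite -[X in measurable X]setTI; exact: measurable_coord_rV.
  by apply/seteqP; split => x /= H i; [move=> _; exact: (H i)|exact: (H i I)].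
rewrite /measure_rV_cons /pushforward -product_measure1E//; last exact: mA.
congr (_ _); apply/seteqP; split => [[x y] /= H|[x y] /= [H1 H2] i].
  by split=> [|i]; [have := H ord0|have := H (lift ord0 i)];
    rewrite ?rV_cons0 ?rV_consS.
by case: (unliftP ord0 i) => [j|] ->; rewrite ?rV_cons0 ?rV_consS.
Qed.

End lebesgue_rV.
Arguments lebesgue_rV R n : clear implicits.

Section scheme.
Context {R : realType} {d : nat}.
Implicit Types (f g w : 'rV[R]_d -> R) (phi : 'rV[R]_d -> R).
Local Notation mu := (lebesgue_rV R d).

Definition bounded_measurable f : Prop := f \in Lfun mu +oo%E.

Definition in_L2 f : Prop := f \in Lfun mu 2%:E.

Definition Linfty_norm f : \bar R := ('N[mu]_+oo [EFin \o f])%E.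

Definition L2_norm f : \bar R := ('N[mu]_2%:E [EFin \o f])%E.

Definition nonneg_bounded f : Prop :=
  (\forall x \ae mu, (0 <= (f x)%:E <= Linfty_norm f)%E) /\
  (Linfty_norm f < +oo)%E.

Definition partial (i : 'I_d) f : 'rV[R]_d -> R :=
  fun x => 'D_(delta_mx ord0 i) f x.

Definition laplacian f : 'rV[R]_d -> R :=
  fun x => \sum_(i < d) partial i (partial i f) x.

(* C^oo: the partial derivatives of all orders exist and are continuous. *)
Definition smooth f : Prop := forall s : seq 'I_d,
  continuous (foldr partial f s) /\
  forall (i : 'I_d) x, derivable (foldr partial f s) x (delta_mx ord0 i).

Definition test_function phi : Prop :=
  smooth phi /\ compact (closure [set x | phi x != 0]).

(* Distributions are represented by their action on test functions. *)
Definition distr_of f : ('rV[R]_d -> R) -> R :=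
  fun phi => \int[mu]_x (f x * phi x).

Definition distr_laplacian (T : ('rV[R]_d -> R) -> R) :
    ('rV[R]_d -> R) -> R :=
  fun phi => T (laplacian phi).

(* (w' - w) / tau - D Delta w' = g in the sense of distributions *)
Definition elliptic_step (tau D : R) w w' g : Prop :=
  forall phi, test_function phi ->
    distr_of (fun x => (w' x - w x) / tau) phi
      - D * distr_laplacian (distr_of w') phi = distr_of g phi.

Record scheme_step (eps lam tau d1 d2 : R)
    (u v p u' v' p' : 'rV[R]_d -> R) : Prop := {
  scheme_p : \forall x \ae mu,
    (p' x - p x) / tau = eps^-1 * ((1 - p' x) * u x - v x * p' x);
  scheme_u : elliptic_step tau d1 u u'
    (fun x => - eps^-1 * u' x * (v x + lam * (1 - p' x)));
  scheme_v : elliptic_step tau d2 v v'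
    (fun x => - eps^-1 * v' x * (u' x + lam * p' x)) }.

End scheme.

(* Main.v *)
Require Import Defs.
From mathcomp Require Import all_boot all_order all_algebra.
From mathcomp Require Import all_classical all_reals all_analysis.
From mathcomp Require Import measurable_realfun ess_sup_inf.
From mathcomp Require Import ring lra.

Set Implicit Arguments.
Unset Strict Implicit.
Unset Printing Implicit Defensive.
Import Order.TTheory GRing.Theory Num.Theory.
Import numFieldNormedType.Exports.

Local Open Scope classical_set_scope.
Local Open Scope ring_scope.

(** Given the old unknowns, the equations for [u] and for [v] at the new time
    are linear and elliptic,
      (1 + c) w' - kap * Laplacian w' = w,     kap = tau D > 0,  c >= 0,
    where c >= 0 as long as u, v >= 0 and 0 <= p <= 1. Two facts suffice: a
    maximum principle (w >= 0 forces w' >= 0), which together with the explicit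
    formula for p propagates these bounds, and the contraction
    |w'|_2 <= |w|_2. Formally both follow by testing the equation with B'(w')
    for a convex B, since the integral of B'(w') Laplacian w' is minus that of
    B''(w') |grad w'|^2. But w' is only a bounded distributional solution: it
    need not be differentiable, and its integrability is part of the claim.

    The substitute is the Kato-type inequality [kato]. Let
    psi_a(x) = exp (- a (|x_1| + ... + |x_d|)). If w, g are bounded and
    Laplacian w = g in the sense of distributions, then
      int B'(w) g psi_a <= 4 d a^2 int B(w) psi_a.
    It involves no derivative of w and is proved without integrating by parts.
    Mollify w to W. Convexity gives, for every h and direction e_j,
      B'(W(x)) (W(x + h e_j) + W(x - h e_j) - 2 W(x))
        <= B(W(x + h e_j)) + B(W(x - h e_j)) - 2 B(W(x));
    integrated against psi_a, translation invariance moves the second difference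
    on the right to the weight, where it is explicit
    ([wint_second_difference]). Dividing by h^2 and letting h tend to 0 proves
    the inequality for W ([mollified_kato]), because the second difference
    quotients of the mollifier converge uniformly ([lap_error_kernel]). The
    mollification radius is then sent to 0; this uses that translations are
    continuous in L^1(psi_a) on bounded functions ([oscillation_bounded]).

    With kap g = (1 + c) w' - w, the choice B(s) = min(s, 0)^2 and a so small
    that 4 d kap a^2 <= 1 forces int min(w', 0)^2 psi_a = 0, which is the
    maximum principle ([weak_nonneg]). The choice B(s) = s^2 gives
      (1 - 4 d kap a^2) int w'^2 psi_a <= int w^2,
    and a tending to 0 gives the contraction ([weak_contraction]), including
    w' in L^2. Finally, the new p is a convex combination of the old p, 1 and 0. *)

(** * Iterated integrals and translation invariance *)

Section integral_lebesgue_rV.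
Context {R : realType}.

Lemma measurable_addr_rV n (z : 'rV[R]_n) :
  measurable_fun [set: 'rV[R]_n] (fun x : 'rV[R]_n => x + z).
Proof.
apply: measurable_fun_rVP => i.
rewrite (_ : (fun _ => _) = (fun x : 'rV[R]_n => x ord0 i + z ord0 i)).
  by apply: measurable_funD => //; exact: measurable_coord_rV.
by apply/funext => x; rewrite mxE.
Qed.

Lemma ge0_integral_rV_cons n (f : 'rV[R]_n.+1 -> \bar R) :
  measurable_fun setT f -> (forall x, 0 <= f x)%E ->
  (\int[lebesgue_rV R n.+1]_x f x =
   \int[lebesgue_measure]_s \int[lebesgue_rV R n]_x f (rV_cons (s, x)))%E.
Proof.
move=> mf f0.
rewrite [LHS](_ : _ = \int[pushforward (@lebesgue_measure R \x lebesgue_rV R n)%E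
    (@rV_cons R n)]_x f x)%E //.
rewrite ge0_integral_pushforward//=; last exact: measurable_rV_cons.
rewrite preimage_setT fubini_tonelli1//=.
by apply: measurableT_comp => //; exact: measurable_rV_cons.
Qed.

Lemma ge0_integral_shift (f : R -> \bar R) (z : R) :
  measurable_fun setT f -> (forall x, 0 <= f x)%E ->
  (\int[@lebesgue_measure R]_x f (x + z)%R = \int[lebesgue_measure]_x f x)%E.
Proof.
move=> mf f0.
have mz : measurable_fun [set: measurableTypeR R] (fun x : R => x + z : measurableTypeR R).
  by apply: measurable_funD.
pose phi x : measurableTypeR R := x + z.
transitivity (\int[pushforward (@lebesgue_measure R) phi]_x f x)%E.
  by rewrite ge0_integral_pushforward//=.
apply: eq_measure_integral => A mA _; apply/esym.
apply: lebesgue_measure_unique => //= _ [[a b]] _ <-.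
rewrite /pushforward.
rewrite (_ : _ @^-1` _ = `]a - z, b - z]%classic).
  rewrite /= !lebesgue_measure_itv/= !lte_fin ltrD2r -!EFinB.
  by rewrite (_ : b - z - (a - z) = b - a)//; ring.
by apply/seteqP; split => x /=; rewrite !in_itv/= ltrBlDr lerBrDr.
Qed.

Lemma rV_cons_add n (s : R) (x : 'rV[R]_n) (z : 'rV[R]_n.+1) :
  rV_cons (s, x) + z = rV_cons (s + z ord0 ord0, x + \row_i z ord0 (lift ord0 i)).
Proof.
apply/rowP => i; rewrite mxE; case: (unliftP ord0 i) => [j|] ->.
  by rewrite !rV_consS/= !mxE.
by rewrite !rV_cons0.
Qed.

Lemma measurable_fun_rV_cons n (f : 'rV[R]_n.+1 -> \bar R) :
  measurable_fun setT f -> forall s, measurable_fun setT (fun x => f (rV_cons (s, x))).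
Proof.
move=> mf s; apply: (measurableT_comp mf).
by apply: (measurableT_comp measurable_rV_cons); exact: measurable_fun_pair.
Qed.

Lemma ge0_integral_translation n (f : 'rV[R]_n -> \bar R) (z : 'rV[R]_n) :
  measurable_fun setT f -> (forall x, 0 <= f x)%E ->
  (\int[lebesgue_rV R n]_x f (x + z)%R = \int[lebesgue_rV R n]_x f x)%E.
Proof.
elim: n f z => [|n IH] f z mf f0.
  by apply: eq_integral => x _; rewrite (thinmx0 z) addr0.
rewrite [RHS](ge0_integral_rV_cons mf f0) [LHS]ge0_integral_rV_cons//; last first.
  by apply: (measurableT_comp mf); exact: measurable_addr_rV.
rewrite (eq_integral (fun s : measurableTypeR R => \int[lebesgue_rV R n]_x
    f (rV_cons ((s + z ord0 ord0 : R)%R, x))))%E; last first.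
  move=> s _; under eq_integral do rewrite rV_cons_add.
  rewrite (IH (fun x => f (rV_cons (s + z ord0 ord0, x))))//.
  exact: measurable_fun_rV_cons.
apply: (@ge0_integral_shift (fun s => \int[lebesgue_rV R n]_x f (rV_cons (s, x))))%E.
  apply: (measurable_fun_fubini_tonelli_F (f \o rV_cons)) => //=.
  by apply: (measurableT_comp mf); exact: measurable_rV_cons.
by move=> s; exact: integral_ge0.
Qed.

Lemma measurable_prod_coord n (F : 'I_n -> R -> R) :
  (forall i, measurable_fun setT (F i)) ->
  measurable_fun setT (fun x : 'rV[R]_n => \prod_i F i (x ord0 i)).
Proof.
move=> mF; apply: measurable_prod => i _.
by apply: (measurableT_comp (mF i)); exact: measurable_coord_rV.
Qed.

Lemma ge0_integral_prod_coord n (F : 'I_n -> R -> R) :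
  (forall i, measurable_fun setT (F i)) -> (forall i s, 0 <= F i s) ->
  (\int[lebesgue_rV R n]_x (\prod_i F i (x ord0 i))%:E =
   \prod_i \int[lebesgue_measure]_s (F i s)%:E)%E.
Proof.
elim: n F => [|n IH] F mF F0.
  under eq_integral do rewrite big_ord0.
  by rewrite big_ord0 integral_dirac//= diracT mul1e.
rewrite ge0_integral_rV_cons; last 2 first.
- by apply/measurable_EFinP; exact: measurable_prod_coord.
- by move=> x; rewrite lee_fin prodr_ge0.
rewrite big_ord_recl -IH//.
under eq_integral => s _.
  under eq_integral => x _.
    rewrite big_ord_recl rV_cons0/=.
    under eq_bigr do rewrite rV_consS/=.
    rewrite EFinM; over.
  rewrite ge0_integralZl//=; last 3 first.
  - by apply/measurable_EFinP; apply: (measurable_prod_coord (F := fun i => F (lift ord0 i))).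
  - by move=> x _; rewrite lee_fin prodr_ge0.
  - by rewrite lee_fin.
  over.
rewrite ge0_integralZr//=.
- by apply/measurable_EFinP; exact: mF.
- by move=> s _; rewrite lee_fin.
- by apply: integral_ge0 => x _; rewrite lee_fin prodr_ge0.
Qed.

End integral_lebesgue_rV.

(** * Smooth bump functions on the line *)

Section smooth_bump.
Context {R : realType}.

(** Used where the two branches of [flat_exp] meet: there a quadratic bound is
    all that is known, and it is enough. *)
Lemma is_derive_quadratic0 (f : R -> R) (x C : R) :
  (forall h, `|f (x + h) - f x| <= C * h ^+ 2) -> is_derive x 1 f 0.
Proof.
move=> fC.
have H : (fun h : R => h^-1 *: ((f \o shift x) (h *: 1) - f x)) @ 0^' --> (0 : R).
  apply/cvgrPdist_le => e e0.
  have C0 : 0 <= C by have := fC 1; rewrite expr1n mulr1; apply: le_trans.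
  near=> h.
  have h0 : h != 0 by near: h; exact: nbhs_dnbhs_neq.
  have hC : `|h| * (C + 1) <= e.
    rewrite -ler_pdivlMr ?ltr_wpDl//.
    near: h; apply: dnbhs0_le; rewrite divr_gt0// ltr_wpDl//.
  rewrite sub0r normrN /= normrZ normfV.
  rewrite -[h *: 1]/(h * 1) mulr1 (addrC h x).
  rewrite ler_pdivrMl ?normr_gt0//.
  apply: (le_trans (fC h)); rewrite -real_normK ?num_real// expr2 mulrCA.
  rewrite ler_wpM2l//; apply: le_trans hC.
  by rewrite mulrC ler_wpM2l// lerDl.
apply: DeriveDef; first by apply/cvg_ex; exists 0.
exact/cvg_lim.
Unshelve. all: by end_near. Qed.

(** The functions t^-m exp (- 1 / t), extended by 0, are closed under
    differentiation up to linear combinations ([is_derive_flat_exp]); allowing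
    all m avoids any statement about iterated derivatives of exp (- 1 / t). *)
Definition flat_exp (m : nat) (t : R) : R :=
  if 0 < t then t ^- m * expR (- t^-1) else 0.

Lemma flat_expM m k t : flat_exp m t = t ^+ k * flat_exp (k + m) t.
Proof.
rewrite /flat_exp; case: ifPn => [t0|]; last by rewrite mulr0.
by rewrite mulrA exprD invfM mulrA mulfV ?mul1r// expf_neq0// gt_eqF.
Qed.

Lemma flat_exp_ge0 m t : 0 <= flat_exp m t.
Proof.
rewrite /flat_exp; case: ifPn => // t0.
by rewrite mulr_ge0// ?expR_ge0// invr_ge0 exprn_ge0// ltW.
Qed.

(** Compare exp (1 / t) with the term of degree m + 2 of its power series. *)
Lemma flat_exp_quadratic m t : flat_exp m t <= (m.+2)`!%:R * t ^+ 2.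
Proof.
rewrite (flat_expM _ 2) mulrC ler_wpM2r ?sqr_ge0// /flat_exp.
case: ifPn => // t0; rewrite expRN -exprVn.
rewrite ler_pdivrMr ?expR_gt0//.
have ti : 0 <= t^-1 by rewrite invr_ge0 ltW.
have := expR_ge1Dxn m.+1 ti.
rewrite -lerBrDl ler_pdivrMr ?ltr0n ?fact_gt0// => /le_trans; apply.
by rewrite mulrC ler_wpM2l// gerBl.
Qed.

Lemma is_derive_expn n (t : R) :
  is_derive t 1 (fun s : R => s ^+ n) (n%:R * t ^+ n.-1).
Proof.
rewrite (_ : (fun s => _) = (id : R -> R) ^+ n); last first.
  by apply/funext => s; rewrite exprfctE.
by apply: (is_derive_eq (is_deriveX n (is_derive_id _ _))); exact: mulr1.
Qed.

Lemma is_derive_flat_exp m (t : R) :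
  is_derive t 1 (flat_exp m) (flat_exp m.+2 t - m%:R * flat_exp m.+1 t).
Proof.
have [t0|t0|t0] := ltgtP t 0.
- have -> : flat_exp m.+2 t - m%:R * flat_exp m.+1 t = 0.
    by rewrite /flat_exp ltNge (ltW t0)/= mulr0 subr0.
  apply: (@near_eq_is_derive _ _ _ (cst 0)) => //.
  by near=> s; rewrite /flat_exp ltNge (_ : s <= 0)//;
    near: s; exact: lt_le_nbhsl.
- apply: (@near_eq_is_derive R R R (fun s : R => (s ^+ m)^-1 * expR (- s^-1))).
    near=> s; rewrite /flat_exp (_ : 0 < s)//; near: s; exact: lt_nbhsr.
  rewrite /flat_exp t0.
  have tn0 : t != 0 by rewrite gt_eqF.
  have d1 := is_derive_expn m t.
  have d2 : is_derive t 1 (fun s : R => (s ^+ m)^-1) (- (t ^+ m) ^- 2 *: (m%:R * t ^+ m.-1)).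
    by apply: is_deriveV => //; rewrite expf_neq0.
  have d3 : is_derive t 1 (fun s : R => s^-1) (- t ^- 2 *: 1).
    exact: (@is_deriveV _ id).
  have d4 : is_derive t 1 (fun s : R => - s^-1) (- (- t ^- 2 *: 1)).
    exact: (@is_deriveN _ _ _ (fun s : R => s^-1)).
  have d5 : is_derive t 1 (expR \o (fun s : R => - s^-1)) (expR (- t^-1) * - (- t ^- 2 *: 1)).
    exact: is_derive1_comp.
  rewrite (_ : (fun s => _) = (fun s : R => (s ^+ m)^-1) * (expR \o (fun s : R => - s^-1)))//.
  apply: (is_derive_eq (is_deriveM d2 d5)); rewrite /GRing.scale/=.
  move: (expR _) => e {d1 d2 d3 d4 d5}; rewrite -!exprVn.
  case: m => [|m]; first by rewrite !expr0; ring.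
  have : t^-1 ^+ m * t ^+ m = 1 by rewrite -exprMn mulVf// expr1n.
  rewrite -pred_Sn !exprS; move: (t^-1) (t ^+ m) => i c; move: (i ^+ m) => a ac.
  apply/eqP; rewrite -subr_eq0.
  rewrite (_ : _ - _ = (1 - a * c) * (m.+1%:R * e * i ^+ 2 * a)); last by ring.
  by rewrite ac subrr mul0r.
- have -> : flat_exp m.+2 t - m%:R * flat_exp m.+1 t = 0.
    by rewrite t0 /flat_exp ltxx/= mulr0 subr0.
  apply: (@is_derive_quadratic0 _ _ (m.+2)`!%:R) => h.
  rewrite t0 add0r {2}/flat_exp ltxx subr0 ger0_norm ?flat_exp_ge0//.
  exact: flat_exp_quadratic.
Unshelve. all: by end_near. Qed.

(** A smooth function together with all its derivatives. Carrying the derivatives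
    explicitly makes the higher partial derivatives of products computable. *)
Definition derivative_tower (b : nat -> R -> R) : Prop :=
  forall k (x : R), is_derive x 1 (b k) (b k.+1 x).

(** The k-th derivative of exp (- 1 / (1 - x^2)) is this polynomial times
    [flat_exp] of order 2 k at 1 - x^2; the recursion is what the chain rule
    gives. *)
Fixpoint std_bump_poly (k : nat) : {poly R} :=
  if k is k'.+1 then
    (std_bump_poly k')^`() * (1 - 'X^2) ^+ 2
    - std_bump_poly k' * 'X *+ 2
    + std_bump_poly k' * 'X * (1 - 'X^2) *+ (4 * k')
  else 1.

Definition std_bump (k : nat) (x : R) : R :=
  (std_bump_poly k).[x] * flat_exp k.*2 (1 - x ^+ 2).

Lemma std_bump_tower : derivative_tower std_bump.
Proof.
move=> k x; rewrite /std_bump.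
have d1 : is_derive x 1 (fun s : R => 1 - s ^+ 2) (- (2 * x)).
  rewrite -sub0r; apply: (@is_deriveB R R R (cst (1 : R)) (fun s : R => s ^+ 2)).
  by apply: (is_derive_eq (is_derive_expn 2 x)); rewrite expr1.
have d2 := @is_derive1_comp _ (flat_exp k.*2) (fun s : R => 1 - s ^+ 2) x _ _
  (is_derive_flat_exp _ _) d1.
rewrite (_ : (fun s => _) = horner (std_bump_poly k) *
  (flat_exp k.*2 \o (fun s : R => 1 - s ^+ 2)))//.
apply: (is_derive_eq (is_deriveM (is_derive_poly (std_bump_poly k) x) d2)).
rewrite /GRing.scale/= doubleS.
rewrite (flat_expM k.*2 2 (1 - x ^+ 2)) (flat_expM k.*2.+1 1 (1 - x ^+ 2)).
rewrite !add2n add1n.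
rewrite !(hornerD, hornerN, hornerM, hornerXn, hornerX, hornerC, hornerMn, horner_exp)/=.
move: (flat_exp _ _) (std_bump_poly k).[x] (std_bump_poly k)^`().[x] => E p q.
rewrite -(mulr_natr _ (4 * k)) -(mulr_natr _ 2) -muln2 !natrM.
move: (k%:R : R) => r; ring.
Qed.

Lemma std_bump_out k x : 1 <= `|x| -> std_bump k x = 0.
Proof.
move=> x1; rewrite /std_bump /flat_exp ifF ?mulr0//.
by rewrite subr_gt0 -real_normK ?num_real// ltNge exprn_ege1.
Qed.

Lemma std_bump_ge0 x : 0 <= std_bump 0 x.
Proof. by rewrite /std_bump hornerC mul1r flat_exp_ge0. Qed.

Lemma std_bump_gt0 x : `|x| < 1 -> 0 < std_bump 0 x.
Proof.
move=> x1; rewrite /std_bump hornerC mul1r /flat_exp.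
by rewrite subr_gt0 -real_normK ?num_real// expr_lt1// x1 expr0 invr1 mul1r expR_gt0.
Qed.

(** Chain rule for an affine substitution: it yields the translates and
    rescalings of a bump, and the reflection used for second differences. *)
Lemma derivative_tower_affine (b : nat -> R -> R) (r c a : R) :
  derivative_tower b ->
  derivative_tower (fun k x => a * r ^+ k * b k (r * x + c)).
Proof.
move=> tb k x.
have d1 : is_derive x 1 (fun s : R => r * s + c) r.
  rewrite (_ : (fun s => _) = (r \*: id) + cst c)//.
  apply: (is_derive_eq (is_deriveD (is_deriveZ r (is_derive_id _ _)) (is_derive_cst _ _ _))).
  by rewrite addr0; exact: mulr1.
have d2 := @is_derive1_comp _ (b k) (fun s : R => r * s + c) x _ _ (tb k _) d1.
rewrite (_ : (fun s => _) = (a * r ^+ k) \*: (b k \o (fun s : R => r * s + c)))//.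
by apply: (is_derive_eq (is_deriveZ (a * r ^+ k) d2)); rewrite /GRing.scale/= exprS; ring.
Qed.

Lemma derivative_tower_continuous (b : nat -> R -> R) k :
  derivative_tower b -> continuous (b k).
Proof.
move=> tb x; apply: differentiable_continuous; apply/derivable1_diffP.
by have [] := tb k x.
Qed.

Lemma derivative_tower_bounded (b : nat -> R -> R) (r : R) : 0 <= r ->
  derivative_tower b -> (forall k x, r <= `|x| -> b k x = 0) ->
  forall k, exists2 K, 0 <= K & forall x, `|b k x| <= K.
Proof.
move=> r0 tb bout k.
have rr : - r <= r by rewrite ge0_cp.
have cb : {within `[- r, r]%classic, continuous (fun x => `|b k x|)}.
  apply: continuous_subspaceT => x.
  apply: (@continuous_comp _ _ _ (b k) Num.norm); first exact: derivative_tower_continuous.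
  exact: norm_continuous.
have [c _ Hc] := EVT_max rr cb.
exists `|b k c| => // x.
have [xr|xr] := leP r `|x|; first by rewrite (bout _ _ xr) normr0.
by apply: Hc; rewrite in_itv/= -ler_norml ltW.
Qed.

End smooth_bump.

(** * Mollifiers and second differences on the line *)

Section mollifier.
Context {R : realType}.

(** Only the support and the unit mass have to be arranged: rescale the standard
    bump and divide by its integral, which is finite and nonzero. *)
Lemma mollifier_exists (r : R) : 0 < r -> exists b : nat -> R -> R,
  [/\ derivative_tower b, forall k s, r <= `|s| -> b k s = 0,
      forall s, 0 <= b 0%N s & (\int[lebesgue_measure]_s (b 0%N s)%:E = 1)%E].
Proof.
move=> r0.
pose b0 (k : nat) (s : R) : R := 1 * r^-1 ^+ k * std_bump k (r^-1 * s + 0).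
have tb0 : derivative_tower b0 by apply: derivative_tower_affine; exact: std_bump_tower.
have b0out k s : r <= `|s| -> b0 k s = 0.
  move=> rs; rewrite /b0 std_bump_out ?mulr0// addr0 normrM gtr0_norm ?invr_gt0//.
  by rewrite ler_pdivlMl// mulr1.
have b0_ge0 s : 0 <= b0 0%N s by rewrite /b0 expr0 !mul1r std_bump_ge0.
have b0_gt0 s : `|s| < r -> 0 < b0 0%N s.
  move=> sr; rewrite /b0 expr0 !mul1r std_bump_gt0// addr0 normrM gtr0_norm ?invr_gt0//.
  by rewrite ltr_pdivrMl// mulr1.
have mb0 : measurable_fun setT (b0 0%N).
  by apply: continuous_measurable_fun; exact: derivative_tower_continuous.
have mEb0 : measurable_fun setT (fun s => (b0 0%N s)%:E) by exact/measurable_EFinP.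
set I := (\int[lebesgue_measure]_s (b0 0%N s)%:E)%E.
have I0 : (0 <= I)%E by apply: integral_ge0 => s _; rewrite lee_fin.
have Ioo : (I < +oo)%E.
  have [K K0 bK] := derivative_tower_bounded (ltW r0) tb0 b0out 0%N.
  have : (I <= \int[lebesgue_measure]_(s in [set` `[(- r)%R, r]%R]) K%:E)%E.
    rewrite [leRHS]integral_mkcond; apply: ge0_le_integral => //.
    - by move=> s _; rewrite lee_fin.
    - by apply/(measurable_restrictT _ _).1 => //; exact: measurable_cst.
    - move=> s _; rewrite patchE; case: ifPn.
        by rewrite lee_fin (le_trans _ (bK s))// ler_norm.
      rewrite notin_setE/= in_itv/= -ler_norml => /negP; rewrite -ltNge => /ltW rs.
      by rewrite lee_fin b0out.
  move=> /le_lt_trans; apply.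
  rewrite integral_cst//= lebesgue_measure_itv/=.
  by case: ifPn => _; rewrite ?mule0 ?ltry// -EFinD -EFinM ltry.
have IN0 : I != 0%E.
  apply/negP => /eqP I_eq0.
  have : (\int[lebesgue_measure]_s `|(b0 0%N s)%:E| = 0)%E.
    rewrite -[RHS]I_eq0; apply: eq_integral => s _.
    by rewrite gee0_abs// lee_fin.
  move=> /(ae_eq_integral_abs lebesgue_measure measurableT mEb0)[N [mN N0 sN]].
  have : (lebesgue_measure [set` `](- r)%R, r[%R] <= lebesgue_measure N)%E.
    apply: le_measure; rewrite ?inE//=.
    move=> s /=; rewrite in_itv/= -ltr_norml => sr.
    by apply: sN => /= /(_ Logic.I)/eqP; rewrite eqe gt_eqF// b0_gt0.
  rewrite N0 lebesgue_measure_itv/= lte_fin gtrN// -EFinD lee_fin.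
  by rewrite opprK leNgt addr_gt0.
pose c := fine I.
have cE : I = c%:E by rewrite fineK// ge0_fin_numE.
have c0 : 0 < c by rewrite -lte_fin -cE lt_neqAle eq_sym IN0.
exists (fun k s => c^-1 * b0 k s); split.
- move=> k s.
  exact: (is_deriveZ c^-1 (tb0 k s)).
- by move=> k s rs; rewrite b0out ?mulr0.
- by move=> s; rewrite mulr_ge0// invr_ge0 ltW.
- under eq_integral do rewrite EFinM.
  rewrite ge0_integralZl//=.
  + by rewrite -/I cE -EFinM mulVf// gt_eqF.
  + by move=> s _; rewrite lee_fin.
  + by rewrite lee_fin invr_ge0 ltW.
Qed.

Lemma tower_lipschitz (b : nat -> R -> R) k (K : R) : derivative_tower b ->
  (forall s, `|b k.+1 s| <= K) -> forall s t, `|b k s - b k t| <= K * `|s - t|.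
Proof.
move=> tb bK.
have H s t : s <= t -> `|b k t - b k s| <= K * `|t - s|.
  move=> st.
  have [c _ ->] := @MVT_segment R (b k) (b k.+1) s t st (fun x _ => tb k x)
    (continuous_subspaceT (derivative_tower_continuous tb)).
  by rewrite normrM ler_wpM2r.
move=> s t; have [st|/ltW st] := leP t s; first exact: H.
by rewrite distrC (distrC s); exact: H.
Qed.

(** Two applications of the mean value theorem, to the remainder as a function of
    h and then to the first derivative, leave a difference of second derivatives,
    which is controlled by the third. Uniformity in s is what matters later. *)
Lemma second_difference_bound (b : nat -> R -> R) (K : R) : derivative_tower b ->
  (forall s, `|b 3 s| <= K) -> forall s h, 0 <= h ->
  `|b 0%N (s + h) + b 0%N (s - h) - 2 * b 0%N s - h ^+ 2 * b 2%N s| <= 2 * K * h ^+ 3.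
Proof.
move=> tb bK s h h0.
have K0 : 0 <= K by exact: le_trans (bK 0).
(* The remainder as a function of t; it vanishes at 0. *)
pose phi t := b 0%N (s + t) + b 0%N (s - t) - 2 * b 0%N s - t ^+ 2 * b 2%N s.
pose dphi t := b 1%N (s + t) - b 1%N (s - t) - 2 * t * b 2%N s.
have tp := derivative_tower_affine 1 s 1 tb.
have tm := derivative_tower_affine (-1) s 1 tb.
have dphiP (t : R) : is_derive t 1 phi (dphi t).
  have d1 := is_deriveD (tp 0%N t) (tm 0%N t).
  have d2 := is_deriveZ (b 2%N s) (is_derive_expn 2 t).
  have := is_deriveB (is_deriveB d1 (is_derive_cst (2 * b 0%N s) t 1)) d2.
  rewrite (_ : (_ - _ - _) = phi); last first.
    apply/funext => x; rewrite !fctE /phi /GRing.scale/= !expr0 !mul1r mulN1r.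
    by rewrite (addrC x s) (addrC (- x) s); congr (_ - _); exact: mulrC.
  move=> d; apply: (is_derive_eq d); rewrite /dphi /GRing.scale/= !expr1 !mul1r !mulN1r.
  by rewrite (addrC t s) (addrC (- t) s); ring.
have cphi : {within `[0, h]%classic, continuous phi}.
  apply: continuous_subspaceT => t; apply: differentiable_continuous.
  by apply/derivable1_diffP; have [] := dphiP t.
have [t] := MVT_segment h0 (fun x _ => dphiP x) cphi.
rewrite in_itv/= => /andP[t0 th].
have -> : phi 0 = 0 by rewrite /phi addr0 subr0; ring.
rewrite !subr0 -/(phi h) => ->.
have st : s - t <= s + t by rewrite lerD2l ge0_cp.
have [c] := @MVT_segment R (b 1%N) (b 2%N) _ _ st (fun x _ => tb 1%N x)
    (continuous_subspaceT (derivative_tower_continuous tb)).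
rewrite in_itv/= => /andP[c1 c2] e.
rewrite /dphi e.
have -> : (b 2%N c * (s + t - (s - t)) - 2 * t * b 2%N s) * h =
  2 * t * h * (b 2%N c - b 2%N s) by ring.
rewrite normrM ger0_norm ?mulr_ge0//.
have := tower_lipschitz tb bK c s.
have cs : `|c - s| <= t by rewrite ler_distl c1 c2.
move=> L.
have L2 : `|b 2%N c - b 2%N s| <= K * h.
  by apply: (le_trans L); rewrite ler_wpM2l// (le_trans cs).
apply: (@le_trans _ _ (2 * t * h * (K * h))).
  by rewrite ler_wpM2l// !mulr_ge0.
rewrite (_ : _ * (K * h) = 2 * K * (t * h ^+ 2)); last by ring.
rewrite (_ : h ^+ 3 = h * h ^+ 2); last by ring.
by rewrite ler_wpM2l ?mulr_ge0// ler_wpM2r// sqr_ge0.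
Qed.

End mollifier.

(** * Products of one-variable functions as test functions *)

Section product_test_functions.
Context {R : realType} {d : nat}.

Definition prod_coord (F : 'I_d -> R -> R) (x : 'rV[R]_d) : R :=
  \prod_i F i (x ord0 i).

Lemma is_derive_prod_coord (F F' : 'I_d -> R -> R) (j : 'I_d) (x : 'rV[R]_d) :
  (forall s : R, is_derive s 1 (F j) (F' j s)) ->
  is_derive x (delta_mx ord0 j) (prod_coord F)
    (prod_coord (fun i => if j == i then F' i else F i) x).
Proof.
move=> dF.
pose C := \prod_(i | i != j) F i (x ord0 i).
have e1 : (fun h : R => h^-1 *: ((prod_coord F \o shift x) (h *: delta_mx ord0 j) - prod_coord F x))
    = (fun h : R => C * (h^-1 *: ((F j \o shift (x ord0 j)) (h *: 1) - F j (x ord0 j)))).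
  apply/funext => h; rewrite /= /prod_coord (bigD1 j)//= [in X in _ - X](bigD1 j)//=.
  rewrite (eq_bigr (fun i => F i (x ord0 i))); last first.
    by move=> i ij; rewrite !mxE/= (negbTE ij)/= mulr0 add0r.
  rewrite -/C !mxE !eqxx/= /GRing.scale/=; ring.
have cvgD : (fun h : R =>
    h^-1 *: ((prod_coord F \o shift x) (h *: delta_mx ord0 j) - prod_coord F x))
    @ 0^' --> C * F' j (x ord0 j).
  rewrite e1; apply: cvgM; first exact: cvg_cst.
  by have [/= + <-] := dF (x ord0 j); apply.
have -> : prod_coord (fun i => if j == i then F' i else F i) x = C * F' j (x ord0 j).
  rewrite /prod_coord (bigD1 j)//= eqxx mulrC; congr (_ * _).
  by apply: eq_bigr => i ij; rewrite eq_sym (negbTE ij).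
apply: DeriveDef; first by apply/cvg_ex; exists (C * F' j (x ord0 j)).
exact/cvg_lim.
Qed.

Lemma continuous_prod_coord (F : 'I_d -> R -> R) :
  (forall i, continuous (F i)) -> continuous (prod_coord F).
Proof.
move=> cF; rewrite /prod_coord.
elim: (index_enum _) => [|i r IH] x.
  rewrite (_ : (fun _ => _) = fun=> 1); first exact: cst_continuous.
  by apply/funext => y; rewrite big_nil.
rewrite (_ : (fun _ => _) = fun y : 'rV[R]_d =>
    F i (y ord0 i) * \prod_(j <- r) F j (y ord0 j)); last first.
  by apply/funext => y; rewrite big_cons.
apply: cvgM; [exact: nbhs_filter| |exact: IH].
apply: (@continuous_comp _ _ _ (fun x : 'rV[R]_d => x ord0 i) (F i));
  [exact: coord_continuous|exact: cF].
Qed.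

(** Each partial derivative acts on one factor only, so a list of partial
    derivatives merely counts how often each coordinate occurs. *)
Lemma foldr_partial_prod_coord (F : 'I_d -> nat -> R -> R) :
  (forall i, derivative_tower (F i)) -> forall s : seq 'I_d,
  foldr partial (prod_coord (fun i => F i 0%N)) s =
  prod_coord (fun i => F i (count_mem i s)).
Proof.
move=> tF; elim=> [//|j s /= ->]; apply/funext => x.
rewrite /partial (_ : 'D__ _ x = prod_coord (fun i => if j == i then
    F i (count_mem i s).+1 else F i (count_mem i s)) x); last first.
  apply: derive_val.
  apply: (is_derive_prod_coord (F' := fun i => F i (count_mem i s).+1)) => t.
  exact: tF.
by apply: eq_bigr => i _; case: eqVneq.
Qed.

Lemma smooth_prod_coord (F : 'I_d -> nat -> R -> R) :
  (forall i, derivative_tower (F i)) -> smooth (prod_coord (fun i => F i 0%N)).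
Proof.
move=> tF s; rewrite foldr_partial_prod_coord//; split.
  by apply: continuous_prod_coord => i; exact: derivative_tower_continuous.
move=> i x; have [] // := @is_derive_prod_coord (fun i => F i (count_mem i s))
  (fun i => F i (count_mem i s).+1) i x (fun t => tF i _ t).
Qed.

Lemma laplacian_prod_coord (F : 'I_d -> nat -> R -> R) :
  (forall i, derivative_tower (F i)) ->
  laplacian (prod_coord (fun i => F i 0%N)) =
  fun x => \sum_j prod_coord (fun i => F i (if i == j then 2 else 0)%N) x.
Proof.
move=> tF; apply/funext => x; apply: eq_bigr => j _.
rewrite -[partial j _]/(foldr partial _ [:: j; j]) foldr_partial_prod_coord//.
by apply: eq_bigr => i _ /=; rewrite eq_sym; case: eqVneq.
Qed.

Lemma test_function_prod_coord (F : 'I_d -> nat -> R -> R) (c : 'I_d -> R) (r : R) :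
  (forall i, derivative_tower (F i)) ->
  (forall i s, r <= `|s - c i| -> F i 0%N s = 0) ->
  test_function (prod_coord (fun i => F i 0%N)).
Proof.
move=> tF Fout; split; first exact: smooth_prod_coord.
pose B := [set x : 'rV[R]_d | forall i, `[c i - r, c i + r]%classic (x ord0 i)].
have cB : compact B.
  apply: (@rV_compact R d (fun i => `[c i - r, c i + r]%classic)) => i.
  exact: segment_compact.
apply: (subclosed_compact _ cB); first exact: closed_closure.
have clB : closed B by apply: compact_closed => //; exact: norm_hausdorff.
rewrite (closure_id B).1//; apply: closureS => x /= px i.
suff : `|x ord0 i - c i| <= r by rewrite ler_distl /= in_itv.
rewrite leNgt; apply/negP => rx.
by move: px; rewrite /prod_coord (bigD1 i)//= Fout ?mul0r ?eqxx// ltW.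
Qed.

End product_test_functions.

(** * The exponential weight *)

Section weight.
Context {R : realType} {d : nat}.
Local Notation mu := (lebesgue_rV R d).
Implicit Types (a h : R) (x z : 'rV[R]_d).

Definition exp_decay a (s : R) : R := expR (- (a * `|s|)).

(** An exponential weight is integrable, changes by a bounded factor under bounded
    translations, and has second differences at most a small multiple of itself.
    The kinks at the coordinate hyperplanes do no harm because the weight is
    never differentiated. *)
Definition weight a : 'rV[R]_d -> R := prod_coord (fun _ => exp_decay a).

Lemma exp_decay_gt0 a s : 0 < exp_decay a s.
Proof. exact: expR_gt0. Qed.

Lemma exp_decay_ge0 a s : 0 <= exp_decay a s.
Proof. exact: expR_ge0. Qed.

Lemma continuous_exp_decay a : continuous (exp_decay a).
Proof.
move=> s; apply: continuous_comp; last exact: continuous_expR.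
apply: (@continuousN _ R^o); apply: continuousM; first exact: cst_continuous.
exact: norm_continuous.
Qed.

Lemma measurable_exp_decay a : measurable_fun setT (exp_decay a).
Proof. by apply: continuous_measurable_fun; exact: continuous_exp_decay. Qed.

(** By symmetry this is twice the integral over the half-line, which is the total
    mass of the exponential distribution up to the factor 1 / a. *)
Lemma integral_exp_decay a : 0 < a ->
  (\int[lebesgue_measure]_s (exp_decay a s)%:E <= (2 / a)%:E)%E.
Proof.
move=> a0; rewrite ge0_symfun_integralT.
- rewrite -set_itvcy EFinM; apply: lee_wpmul2l => //.
  rewrite (_ : a^-1 = a^-1 * 1) ?mulr1//.
  rewrite -(mulr1 (a^-1)) EFinM -(integral_exponential_pdf a0) -ge0_integralZl//=.
  + rewrite integral_mkcond; apply: ge0_le_integral => //.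
    * by move=> s _; apply: erestrict_ge0 => {}s _; rewrite lee_fin exp_decay_ge0.
    * apply/(measurable_restrictT _ _).1 => //; apply/measurable_EFinP.
      by apply: measurable_funTS; exact: measurable_exp_decay.
    * by apply: measurable_funeM; apply/measurable_EFinP; exact: measurable_exponential_pdf.
    * move=> s _; rewrite patchE; case: ifPn => [|_]; last first.
        by rewrite -EFinM lee_fin mulr_ge0 ?invr_ge0 ?(ltW a0) ?exponential_pdf_ge0 ?ltW.
      rewrite inE/= in_itv/= andbT => s0.
      rewrite exponential_pdfE// -EFinM lee_fin mulrA mulVf ?gt_eqF// mul1r.
      by rewrite /exp_decay ger0_norm// mulNr.
  + by apply/measurable_EFinP; exact: measurable_exponential_pdf.
  + by move=> s _; rewrite lee_fin exponential_pdf_ge0 ?ltW.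
  + by rewrite lee_fin invr_ge0 ltW.
- by move=> s; exact: exp_decay_ge0.
- exact: continuous_exp_decay.
- by move=> s; rewrite /= /exp_decay normrN.
Qed.

Lemma weight_gt0 a x : 0 < weight a x.
Proof. by apply: prodr_gt0 => i _; exact: exp_decay_gt0. Qed.

Lemma weight_ge0 a x : 0 <= weight a x.
Proof. exact/ltW/weight_gt0. Qed.

Lemma measurable_weight a : measurable_fun setT (weight a).
Proof. by apply: measurable_prod_coord => i; exact: measurable_exp_decay. Qed.

Lemma exp_decayD a s t : 0 <= a -> exp_decay a (s + t) <= expR (a * `|t|) * exp_decay a s.
Proof.
move=> a0; rewrite /exp_decay -expRD ler_expR.
rewrite -mulrN -mulrN -mulrDr ler_wpM2l// lerNl opprD opprK.
by rewrite addrC lerBlDr -{1}(addrK t s) (le_trans (ler_normB _ _)).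
Qed.

Lemma weight_shift a x z : 0 <= a -> (forall i, `|z ord0 i| <= 1) ->
  weight a (x + z) <= expR a ^+ d * weight a x.
Proof.
move=> a0 z1; rewrite /weight /prod_coord -[X in _ ^+ X]card_ord -prodr_const -big_split/=.
apply: ler_prod => i _; rewrite exp_decay_ge0/= mxE.
apply: (le_trans (exp_decayD _ _ a0)); rewrite ler_wpM2r ?exp_decay_ge0//.
by rewrite ler_expR ler_piMr.
Qed.

(** From exp (- t) >= 1 - t one gets exp t <= 1 + 2 t for t <= 1/2, and
    exp t + exp (- t) - 2 = exp (- t) (exp t - 1)^2. *)
Lemma expR_second_difference (t : R) : 0 <= t <= 2^-1 -> expR t + expR (- t) <= 2 + 4 * t ^+ 2.
Proof.
move=> /andP[t0 t2].
have t1 : 0 < 1 - t by lra.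
have e1 := expR_ge1Dx (- t).
have e0 := expR_gt0 (-t).
have E : expR t = (expR (- t))^-1 by rewrite expRN invrK.
have e2 : expR t <= 1 + 2 * t.
  rewrite E invf_ple ?posrE//; last by lra.
  apply: (le_trans _ e1); rewrite -div1r ler_pdivrMr; nra.
have -> : expR (- t) = (expR t)^-1 by rewrite expRN.
have e3 : 1 <= expR t by rewrite -expR0 ler_expR.
have e4 : 0 < expR t by exact: expR_gt0.
rewrite -(ler_pM2r e4) mulrDl mulVf ?gt_eqF//.
nra.
Qed.

(** Away from the kink at 0 the ratio of the sum to the value at s is exactly
    exp (a h) + exp (- a h); when the kink lies between the two points it is
    smaller, since beyond the kink the function lies below the exponential that
    continues it. *)
Lemma exp_decay_second_difference a s h : 0 <= a -> 0 <= h -> a * h <= 2^-1 ->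
  exp_decay a (s + h) + exp_decay a (s - h) <= (2 + 4 * (a * h) ^+ 2) * exp_decay a s.
Proof.
move=> a0 h0 ah.
have ah0 : 0 <= a * h by exact: mulr_ge0.
apply: (@le_trans _ _ ((expR (a * h) + expR (- (a * h))) * exp_decay a s)); last first.
  by rewrite ler_wpM2r ?exp_decay_ge0// expR_second_difference// ah0.
wlog s0 : s / 0 <= s.
  move=> H; have [/H//|/ltW s0] := leP 0 s.
  have := H (- s); rewrite oppr_ge0 => /(_ s0).
  rewrite /exp_decay normrN (_ : - s + h = - (s - h)) ?normrN; last by ring.
  rewrite (_ : - s - h = - (s + h)) ?normrN; last by ring.
  by rewrite [X in X <= _]addrC.
have [hs|/ltW sh] := leP h s.
  rewrite le_eqVlt; apply/orP; left; apply/eqP.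
  rewrite /exp_decay (ger0_norm s0) (ger0_norm (addr_ge0 s0 h0)) ger0_norm ?subr_ge0//.
  by rewrite mulrDl -!expRD addrC; congr (expR _ + expR _); ring.
rewrite {1 2}/exp_decay (ger0_norm (addr_ge0 s0 h0)) ler0_norm ?subr_le0//.
rewrite /exp_decay (ger0_norm s0).
rewrite (_ : - (a * (s + h)) = - (a * h) - a * s); last by ring.
rewrite (_ : - (a * - (s - h)) = - (a * h) + a * s); last by ring.
rewrite !expRD -mulrDr.
have ash : a * s <= a * h by rewrite ler_wpM2l.
have as0 : 0 <= a * s by rewrite mulr_ge0.
move: (a * s) (a * h) ash as0 ah0 => p q pq p0 q0.
have q1 : 1 <= expR q by rewrite -expR0 ler_expR.
have p1 : 1 <= expR p by rewrite -expR0 ler_expR.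
have pqe : expR p <= expR q by rewrite ler_expR.
rewrite !expRN; set P := expR p in p1 pqe *; set Q := expR q in q1 pqe *.
have Q0 : 0 < Q by lra. have P0 : 0 < P by lra.
have PQ : P / Q <= Q / P by rewrite ler_pdivrMr// mulrAC ler_pdivlMr//; nra.
rewrite mulrDr mulrDl (mulrC Q^-1 P) (mulrC Q^-1 P^-1) (mulrC P^-1).
by rewrite addrC lerD2r.
Qed.

Lemma prod_coord_shift (F : R -> R) x h (j : 'I_d) :
  prod_coord (fun _ => F) (x + h *: delta_mx ord0 j) =
  F (x ord0 j + h) * \prod_(i | i != j) F (x ord0 i).
Proof.
rewrite /prod_coord (bigD1 j)//= !mxE !eqxx mulr1; congr (_ * _).
by apply: eq_bigr => i ij; rewrite !mxE/= (negbTE ij) mulr0 addr0.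
Qed.

Lemma weight_second_difference a x h (j : 'I_d) : 0 <= a -> 0 <= h -> a * h <= 2^-1 ->
  weight a (x + h *: delta_mx ord0 j) + weight a (x - h *: delta_mx ord0 j)
  <= (2 + 4 * (a * h) ^+ 2) * weight a x.
Proof.
move=> a0 h0 ah; rewrite /weight -scaleNr !prod_coord_shift -mulrDl.
rewrite /prod_coord [in leRHS](bigD1 j)//= mulrA ler_wpM2r//.
  by apply: prodr_ge0 => i _; exact: exp_decay_ge0.
exact: exp_decay_second_difference.
Qed.

Lemma ge0_integral_weight a : 0 < a ->
  (\int[mu]_x (weight a x)%:E < +oo)%E.
Proof.
move=> a0; rewrite ge0_integral_prod_coord//; last 2 first.
- by move=> i; exact: measurable_exp_decay.
- by move=> i s; exact: exp_decay_ge0.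
suff /andP[] : (0 <= \prod_(i < d) \int[lebesgue_measure]_s (exp_decay a s)%:E < +oo)%E by [].
elim/big_ind : _ => [|x y /andP[x0 xoo] /andP[y0 yoo]|i _].
- by rewrite lee01 ltry.
- by rewrite mule_ge0//= lte_mul_pinfty// ge0_fin_numE.
- rewrite integral_ge0/=; last by move=> s _; rewrite lee_fin exp_decay_ge0.
  by apply: le_lt_trans (integral_exp_decay a0) _; rewrite ltry.
Qed.

End weight.

(** * Weighted integrals of bounded functions *)

Section weighted_integral.
Context {R : realType} {d : nat}.
Local Notation mu := (lebesgue_rV R d).
Implicit Types (q f g : 'rV[R]_d -> R) (x z : 'rV[R]_d).

(** Boundedness everywhere rather than almost everywhere: the essentially bounded
    data are replaced by such representatives at the very end. *)
Definition bounded_by (M : R) q : Prop :=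
  measurable_fun setT q /\ forall x, `|q x| <= M.

Definition wint (a : R) q : R := \int[mu]_x (q x * weight a x).

Lemma Rintegral_translation f z : measurable_fun setT f -> (forall x, 0 <= f x) ->
  \int[mu]_x f (x + z) = \int[mu]_x f x.
Proof.
move=> mf f0; rewrite /Rintegral; congr fine.
apply: (ge0_integral_translation (f := EFin \o f)).
  exact/measurable_EFinP.
by move=> x; rewrite lee_fin.
Qed.

Lemma bounded_byD M N q f : bounded_by M q -> bounded_by N f ->
  bounded_by (M + N) (fun x => q x + f x).
Proof.
move=> [mq qM] [mf fN]; split; first exact: measurable_funD.
by move=> x; rewrite (le_trans (ler_normD _ _))// lerD.
Qed.

Lemma bounded_byN M q : bounded_by M q -> bounded_by M (fun x => - q x).
Proof.
move=> [mq qM]; split; last by move=> x; rewrite normrN.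
exact: measurable_funN.
Qed.

Lemma bounded_byB M N q f : bounded_by M q -> bounded_by N f ->
  bounded_by (M + N) (fun x => q x - f x).
Proof. by move=> qM fN; apply: bounded_byD => //; exact: bounded_byN. Qed.

Lemma bounded_byM M N q f : bounded_by M q -> bounded_by N f ->
  bounded_by (M * N) (fun x => q x * f x).
Proof.
move=> [mq qM] [mf fN]; split; first exact: measurable_funM.
by move=> x; rewrite normrM ler_pM.
Qed.

Lemma bounded_by_norm M q : bounded_by M q -> bounded_by M (fun x => `|q x|).
Proof.
move=> [mq qM]; split; first exact: measurableT_comp.
by move=> x; rewrite normr_id.
Qed.

Lemma bounded_by_cst (c : R) : bounded_by `|c| (fun=> c).
Proof. by split => //; exact: measurable_cst. Qed.

Lemma bounded_by_shift M q z : bounded_by M q -> bounded_by M (fun x => q (x + z)).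
Proof.
move=> [mq qM]; split => //.
by apply: (measurableT_comp mq); exact: measurable_addr_rV.
Qed.

Lemma bounded_by_indic (A : set 'rV[R]_d) : measurable A -> bounded_by 1 (\1_A : _ -> R).
Proof.
move=> mA; split; first exact: measurable_indic.
by move=> x; rewrite indicE; case: (_ \in _); rewrite ?normr1 ?normr0.
Qed.

Variable a : R.
Hypothesis a_gt0 : 0 < a.

Lemma integrable_le_weight M f : measurable_fun setT f ->
  (forall x, `|f x| <= M * weight a x) -> mu.-integrable setT (EFin \o f).
Proof.
move=> mf fM.
have iw : mu.-integrable setT (fun x => (M * weight a x)%:E).
  apply: (@eq_integrable _ _ _ _ _ measurableT (fun x => M%:E * (weight a x)%:E)%E) => //.
  apply: integrableZl => //; apply/integrableP; split.
    by apply/measurable_EFinP; exact: measurable_weight.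
  under eq_integral do rewrite gee0_abs ?lee_fin ?weight_ge0//.
  exact: ge0_integral_weight.
apply: le_integrable iw => //; first exact/measurable_EFinP.
by move=> x _; rewrite !abse_EFin lee_fin (le_trans (fM x))// ler_norm.
Qed.

Lemma integrable_weight M q : bounded_by M q ->
  mu.-integrable setT (EFin \o (fun x => q x * weight a x)).
Proof.
move=> [mq qM]; apply: (@integrable_le_weight M).
  by apply: measurable_funM => //; exact: measurable_weight.
by move=> x; rewrite normrM (ger0_norm (weight_ge0 _ _)) ler_wpM2r// weight_ge0.
Qed.

Lemma wintD M N q f : bounded_by M q -> bounded_by N f ->
  wint a (fun x => q x + f x) = wint a q + wint a f.
Proof.
move=> qM fN; rewrite /wint -RintegralD//;
  [|exact: integrable_weight qM|exact: integrable_weight fN].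
by apply: eq_Rintegral => x _; rewrite mulrDl.
Qed.

Lemma wintB M N q f : bounded_by M q -> bounded_by N f ->
  wint a (fun x => q x - f x) = wint a q - wint a f.
Proof.
move=> qM fN; rewrite /wint -RintegralB//;
  [|exact: integrable_weight qM|exact: integrable_weight fN].
by apply: eq_Rintegral => x _; rewrite mulrBl.
Qed.

Lemma wintZ M q (c : R) : bounded_by M q -> wint a (fun x => c * q x) = c * wint a q.
Proof.
move=> qM; rewrite /wint -RintegralZl//; last exact: integrable_weight qM.
by apply: eq_Rintegral => x _; rewrite mulrA.
Qed.

Lemma le_wint M N q f : bounded_by M q -> bounded_by N f ->
  (forall x, q x <= f x) -> wint a q <= wint a f.
Proof.
move=> qM fN qf; apply: le_Rintegral => //;
  [exact: integrable_weight qM|exact: integrable_weight fN|].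
by move=> x _; rewrite ler_wpM2r// weight_ge0.
Qed.

Lemma wint_ge0 q : (forall x, 0 <= q x) -> 0 <= wint a q.
Proof. by move=> q0; apply: Rintegral_ge0 => x _; rewrite mulr_ge0// weight_ge0. Qed.

(** Substitute, so that the translation falls on the weight. *)
Lemma wint_shift M q z : bounded_by M q -> (forall x, 0 <= q x) ->
  (forall i, `|z ord0 i| <= 1) ->
  wint a (fun x => q (x + z)) <= expR a ^+ d * wint a q.
Proof.
move=> qM q0 z1; have [mq qMx] := qM.
have wz x : weight a (x - z) <= expR a ^+ d * weight a x.
  by apply: weight_shift => [|i]; [exact: ltW|rewrite mxE normrN].
have mwz : measurable_fun setT (fun x => weight a (x - z)).
  by apply: (measurableT_comp (measurable_weight a)); exact: measurable_addr_rV.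
rewrite -(wintZ _ qM) /wint.
rewrite (_ : \int[mu]_x (q (x + z) * weight a x) =
    \int[mu]_x (q x * weight a (x - z))); last first.
  rewrite -[RHS](Rintegral_translation z).
  - by apply: eq_Rintegral => x _; rewrite addrK.
  - exact: measurable_funM.
  - by move=> x; rewrite mulr_ge0 ?weight_ge0.
have qC := bounded_byM (bounded_by_cst (expR a ^+ d)) qM.
apply: le_Rintegral => //; last 2 first.
- exact: integrable_weight qC.
- by move=> x _; rewrite -mulrA mulrCA ler_wpM2l.
apply: (@integrable_le_weight (M * expR a ^+ d)); first exact: measurable_funM.
move=> x; rewrite normrM (ger0_norm (weight_ge0 _ _)) -mulrA.
by rewrite ler_pM ?weight_ge0.
Qed.

(** The second difference is moved from q to the weight by translation invariance.
    This plays the role of the two integrations by parts that would turn the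
    integral of psi Laplacian q into that of q Laplacian psi. *)
Lemma wint_second_difference M q h (j : 'I_d) : bounded_by M q -> (forall x, 0 <= q x) ->
  0 <= h -> a * h <= 2^-1 -> h <= 1 ->
  wint a (fun x => q (x + h *: delta_mx ord0 j)) +
  wint a (fun x => q (x - h *: delta_mx ord0 j)) <= (2 + 4 * (a * h) ^+ 2) * wint a q.
Proof.
move=> qM q0 h0 ah h1; have [mq qMx] := qM.
set e := h *: delta_mx ord0 j.
have e1 i : `|e ord0 i| <= 1.
  rewrite !mxE normrM ger0_norm//; case: (_ && _).
    by rewrite normr1 mulr1.
  by rewrite normr0 mulr0.
have shiftE z : wint a (fun x => q (x + z)) = \int[mu]_x (q x * weight a (x - z)).
  rewrite -[RHS](Rintegral_translation z).
  - by apply: eq_Rintegral => x _; rewrite addrK.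
  - apply: measurable_funM => //.
    by apply: (measurableT_comp (measurable_weight a)); exact: measurable_addr_rV.
  - by move=> x; rewrite mulr_ge0 ?weight_ge0.
have int z : (forall i, `|z ord0 i| <= 1) ->
    mu.-integrable setT (EFin \o (fun x => q x * weight a (x + z))).
  move=> z1; apply: (@integrable_le_weight (M * expR a ^+ d)).
    apply: measurable_funM => //.
    by apply: (measurableT_comp (measurable_weight a)); exact: measurable_addr_rV.
  move=> x; rewrite normrM (ger0_norm (weight_ge0 _ _)) -mulrA.
  by rewrite ler_pM ?weight_ge0// weight_shift// ltW.
rewrite !shiftE -RintegralD//; last 2 first.
- by apply: int => i; rewrite mxE normrN.
- by rewrite opprK; exact: int.
have qC := bounded_byM (bounded_by_cst (2 + 4 * (a * h) ^+ 2)) qM.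
rewrite -(wintZ _ qM); apply: le_Rintegral => //.
- have eN i : `|(- e) ord0 i| <= 1 by rewrite mxE normrN.
  have := integrableD measurableT (int _ eN) (int _ e1).
  by apply: eq_integrable => // x _ /=; rewrite opprK.
- exact: integrable_weight qC.
- move=> x _; rewrite opprK -mulrDr -mulrA mulrCA ler_wpM2l// addrC.
  by apply: weight_second_difference => //; exact: ltW.
Qed.

End weighted_integral.

(** * Continuity of translations *)

Section translation_continuity.
Context {R : realType} {d : nat}.
Local Notation mu := (lebesgue_rV R d).
Implicit Types (q f g : 'rV[R]_d -> R) (x z : 'rV[R]_d) (A B : set 'rV[R]_d).

(** The upper limit of F at the origin is at most 0, which for a nonnegative F is
    convergence to 0. *)
Definition vanishes_at0 (F : 'rV[R]_d -> R) : Prop :=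
  forall e, 0 < e -> exists2 r, 0 < r & forall z, (forall i, `|z ord0 i| <= r) -> F z <= e.

Lemma vanishes_at0D F G : vanishes_at0 F -> vanishes_at0 G ->
  vanishes_at0 (fun z => F z + G z).
Proof.
move=> F0 G0 e e0; have e2 : 0 < e / 2 by rewrite divr_gt0.
have [r r0 Fr] := F0 _ e2; have [s s0 Gs] := G0 _ e2.
exists (Num.min r s); first by rewrite lt_min r0.
move=> z zrs; rewrite [leRHS]splitr lerD//; [apply: Fr|apply: Gs] => i;
  by have := zrs i; rewrite le_min => /andP[].
Qed.

Lemma vanishes_at0_le F G : vanishes_at0 G -> (forall z, F z <= G z) -> vanishes_at0 F.
Proof.
move=> G0 FG e e0; have [r r0 Gr] := G0 _ e0.
by exists r => // z zr; rewrite (le_trans (FG z))// Gr.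
Qed.

Lemma vanishes_at0_approx F : (forall e, 0 < e -> exists2 G, vanishes_at0 G &
    forall z, (forall i, `|z ord0 i| <= 1) -> F z <= G z + e) -> vanishes_at0 F.
Proof.
move=> H e e0; have e2 : 0 < e / 2 by rewrite divr_gt0.
have [G G0 FG] := H _ e2; have [r r0 Gr] := G0 _ e2.
exists (Num.min r 1); first by rewrite lt_min r0 ltr01.
move=> z zr; rewrite [leRHS]splitr; apply: (le_trans (FG z _)).
  by move=> i; have := zr i; rewrite le_min => /andP[].
by rewrite lerD2r Gr// => i; have := zr i; rewrite le_min => /andP[].
Qed.

Lemma vanishes_at0Z (c : R) F : 0 <= c -> vanishes_at0 F -> vanishes_at0 (fun z => c * F z).
Proof.
move=> c0 F0 e e0; have c1 : 0 < c + 1 by rewrite ltr_wpDl.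
have [r r0 Fr] := F0 (e / (c + 1)) (divr_gt0 e0 c1).
exists r => // z /Fr Fz.
apply: (@le_trans _ _ (c * (e / (c + 1)))); first by rewrite ler_wpM2l.
by rewrite mulrCA ger_pMr// ler_pdivrMr// mul1r lerDl.
Qed.

Lemma vanishes_at0_sum K (F : nat -> 'rV[R]_d -> R) : (forall k, vanishes_at0 (F k)) ->
  vanishes_at0 (fun z => \sum_(k < K) F k z).
Proof.
move=> F0; elim: K => [|K IH].
  by move=> e e0; exists 1 => // z _; rewrite big_ord0 ltW.
apply: (@vanishes_at0_le _ (fun z => \sum_(k < K) F k z + F K z)).
  exact: vanishes_at0D.
by move=> z; rewrite big_ord_recr.
Qed.

Variable a : R.
Hypothesis a_gt0 : 0 < a.

(** The L^1(psi_a) distance between q and its translate by z. *)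
Definition oscillation q z : R := wint a (fun x => `|q (x + z) - q x|).

Lemma bounded_by_oscillation M q z : bounded_by M q ->
  bounded_by (M + M) (fun x => `|q (x + z) - q x|).
Proof.
move=> qM; apply: bounded_by_norm; apply: bounded_byB => //.
exact: bounded_by_shift.
Qed.

(** The slab has finite width 2 r in direction i only; the weight provides
    integrability in the remaining directions. *)
Lemma wint_slab (i : 'I_d) (c : R) : exists2 C, 0 <= C & forall r, 0 <= r ->
  wint a (fun x => \1_(`[c - r, c + r]%classic) (x ord0 i)) <= C * r.
Proof.
pose P := (\prod_(j < d | j != i) \int[lebesgue_measure]_s (exp_decay a s)%:E)%E.
have P0 : (0 <= P)%E.
  by apply: prode_ge0 => j _; apply: integral_ge0 => s _; rewrite lee_fin exp_decay_ge0.
have Poo : (P < +oo)%E.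
  suff /andP[] : (0 <= P < +oo)%E by [].
  rewrite /P; elim/big_ind : _ => [|x y /andP[x0 xoo] /andP[y0 yoo]|j _].
  - by rewrite lee01 ltry.
  - by rewrite mule_ge0//= lte_mul_pinfty// ge0_fin_numE.
  - rewrite integral_ge0/=; last by move=> s _; rewrite lee_fin exp_decay_ge0.
    by apply: le_lt_trans (integral_exp_decay a_gt0) _; rewrite ltry.
have PE : P = (fine P)%:E by rewrite fineK// ge0_fin_numE.
have fP0 : 0 <= fine P by rewrite fine_ge0.
exists (2 * fine P) => [|r r0]; first by rewrite mulr_ge0.
(* The weighted integral is a product; drop the decay in direction i. *)
pose F j s : R := if j == i then \1_(`[c - r, c + r]%classic) s * exp_decay a s
  else exp_decay a s.
have mF j : measurable_fun setT (F j).
  rewrite /F; case: (j == i); last exact: measurable_exp_decay.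
  by apply: measurable_funM; [exact: measurable_indic|exact: measurable_exp_decay].
have F0 j s : 0 <= F j s.
  by rewrite /F; case: (j == i); rewrite ?mulr_ge0 ?exp_decay_ge0// indicE.
have -> : wint a (fun x => \1_(`[c - r, c + r]%classic) (x ord0 i)) =
    \int[mu]_x (\prod_j F j (x ord0 j)).
  apply: eq_Rintegral => x _; rewrite /weight /prod_coord (bigD1 i)//= [RHS](bigD1 i)//=.
  rewrite /F eqxx mulrA; congr (_ * _).
  by apply: eq_bigr => j /negbTE ->.
rewrite -lee_fin /Rintegral ge0_integral_prod_coord// (bigD1 i)//=.
rewrite (eq_bigr (fun=> \int[lebesgue_measure]_s (exp_decay a s)%:E)%E); last first.
  by move=> j /negbTE ji; apply: eq_integral => s _; rewrite /F ji.
have I2r : (\int[lebesgue_measure]_s (F i s)%:E <= (2 * r)%:E)%E.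
  apply: (@le_trans _ _ (\int[lebesgue_measure]_s (\1_(`[c - r, c + r]%classic) s)%:E)%E).
    apply: ge0_le_integral => //.
    - by move=> s _; rewrite lee_fin.
    - by apply/measurable_EFinP; exact: mF.
    - by apply/measurable_EFinP; exact: measurable_indic.
    - move=> s _; rewrite lee_fin /F eqxx ler_piMr// ?indicE//.
      by rewrite /exp_decay expR_le1 oppr_le0 mulr_ge0// ltW.
  rewrite integral_indic//= setIT lebesgue_measure_itv/=.
  case: ifPn => _; last by rewrite lee_fin mulr_ge0.
  by rewrite -EFinB lee_fin; lra.
have I0 : (0 <= \int[lebesgue_measure]_s (F i s)%:E)%E.
  by apply: integral_ge0 => s _; rewrite lee_fin.
rewrite -/P fineK; last first.
  rewrite ge0_fin_numE ?mule_ge0// lte_mul_pinfty// ge0_fin_numE//.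
  by rewrite (le_lt_trans I2r)// ltry.
rewrite PE mulrAC EFinM lee_wpmul2r// lee_fin.
Qed.

(** A half-space and its translate by z differ inside a slab of width |z_i|. *)
Lemma oscillation_halfspace (i : 'I_d) (c : R) :
  vanishes_at0 (oscillation (\1_[set x | c < x ord0 i])).
Proof.
have [C C0 slab] := wint_slab i c.
have mc : measurable [set x : 'rV[R]_d | c < x ord0 i].
  have := @measurable_coord_rV _ R d i measurableT `]c, +oo[%classic (measurable_itv _).
  rewrite setTI; congr measurable; apply/seteqP; split => x /=; by rewrite in_itv/= andbT.
move=> e e0; have C1 : 0 < C + 1 by rewrite ltr_wpDl.
exists (e / (C + 1)); first exact: divr_gt0.
set r := e / (C + 1) => z zr.
have r0 : 0 <= r by rewrite divr_ge0// ltW.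
apply: (@le_trans _ _ (C * r)); last first.
  by rewrite /r mulrCA ger_pMr// ler_pdivrMr// mul1r lerDl.
apply: le_trans (slab _ r0); apply: (le_wint a_gt0).
- exact: bounded_by_oscillation (bounded_by_indic mc).
- split; last by move=> x; rewrite indicE; case: (_ \in _); rewrite ?normr1 ?normr0.
  have mi : measurable_fun setT (\1_(`[c - r, c + r]%classic) : R -> R).
    exact: measurable_indic.
  exact: (measurableT_comp mi (measurable_coord_rV i)).
move=> x; rewrite !indicE.
have := zr i; rewrite ler_norml => /andP[z1 z2].
case: (boolP (x ord0 i \in _)) => [_|].
  case: (_ \in _); case: (_ \in _); rewrite ?subrr ?subr0 ?sub0r ?normrN ?normr1 ?normr0//.
rewrite notin_setE/= in_itv/= => /negP; rewrite negb_and -!ltNge => /orP[h|h].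
- rewrite !memNset ?subrr ?normr0//= ?mxE; lra.
- rewrite !mem_set ?subrr ?normr0//= ?mxE; lra.
Qed.

Lemma oscillation_set0 : vanishes_at0 (oscillation (\1_set0)).
Proof.
move=> e e0; exists 1 => // z _.
rewrite /oscillation /wint (@eq_Rintegral _ _ _ _ _ (fun=> 0)).
  by rewrite Rintegral_cst// mul0r ltW.
by move=> x _; rewrite !indicE !in_set0 subrr normr0 mul0r.
Qed.

Lemma oscillation_setC A : oscillation (\1_(~` A)) = oscillation (\1_A).
Proof.
apply/funext => z; congr wint; apply/funext => x; rewrite !indicE !in_setC.
by case: (_ \in _); case: (_ \in _) => //=; rewrite ?subrr// ?sub0r ?subr0 normrN.
Qed.

Lemma oscillation_setU A B : measurable A -> measurable B -> forall z,
  oscillation (\1_(A `|` B)) z <= oscillation (\1_A) z + oscillation (\1_B) z.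
Proof.
move=> mA mB z.
have oA := bounded_by_oscillation z (bounded_by_indic mA).
have oB := bounded_by_oscillation z (bounded_by_indic mB).
rewrite /oscillation -(wintD a_gt0 oA oB); apply: (le_wint a_gt0).
- exact: bounded_by_oscillation (bounded_by_indic (measurableU _ _ mA mB)).
- exact: bounded_byD oA oB.
move=> x; rewrite !indicE !in_setU.
by do 4!case: (_ \in _) => /=; rewrite ?subrr ?sub0r ?subr0 ?normrN ?normr1 ?normr0; lra.
Qed.

Lemma wint_tail_cvg0 (F : (set 'rV[R]_d)^nat) : (forall k, measurable (F k)) ->
  forall e, 0 < e -> exists n,
  wint a (\1_(\bigcup_k F k `\` \bigcup_(k < n) F k)) <= e.
Proof.
move=> mF e e0.
pose D n := \bigcup_k F k `\` \bigcup_(k < n) F k.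
have mD n : measurable (D n).
  by apply: measurableD; [exact: bigcupT_measurable|exact: bigcup_measurable].
pose f n x : \bar R := (\1_(D n) x * weight a x)%:E.
have mf n : measurable_fun setT (f n).
  apply/measurable_EFinP; apply: measurable_funM; last exact: measurable_weight.
  exact: measurable_indic.
have ff : {ae mu, forall x, setT x -> f ^~ x @ \oo --> (cst 0 x : \bar R)}.
  apply/nearW => x _.
  apply: cvg_near_cst.
  have [[k _ Fkx]|nx] := pselect ((\bigcup_k F k) x).
    exists k.+1 => // n /= kn; rewrite /f indicE memNset ?mul0r//.
    by case=> _; apply; exists k.
  exists 0%N => // n _; rewrite /f indicE memNset ?mul0r//.
  by case.
have ig : mu.-integrable setT (EFin \o (fun x => 1 * weight a x)).
  by have := integrable_weight a_gt0 (bounded_by_cst 1); apply.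
have fg : {ae mu, forall x n, setT x -> (`|f n x| <= (EFin \o (fun x => (1 * weight a x)%R)) x)%E}.
  apply/nearW => x n _; rewrite /f abse_EFin lee_fin normrM (ger0_norm (weight_ge0 _ _)).
  rewrite ler_wpM2r ?weight_ge0//.
  by have [_] := bounded_by_indic (mD n).
have [_ _] := dominated_convergence measurableT mf (measurable_cst _) ff ig fg.
rewrite integral0 => /fine_cvgP[_] /cvgrPdist_le /(_ _ e0)[n _ /(_ n (leqnn n))] /=.
rewrite sub0r normrN => H; exists n; apply: le_trans H.
exact: ler_norm.
Qed.

(** Translation can increase the weighted measure of the tail of the union by at
    most a fixed factor, so the tail is negligible uniformly in z and only a
    finite union remains. *)
Lemma oscillation_bigcup (F : (set 'rV[R]_d)^nat) : (forall k, measurable (F k)) ->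
  (forall k, vanishes_at0 (oscillation (\1_(F k)))) ->
  vanishes_at0 (oscillation (\1_(\bigcup_k F k))).
Proof.
move=> mF F0.
have mU n : measurable (\bigcup_(k < n) F k) by exact: bigcup_measurable.
have U0 n : vanishes_at0 (oscillation (\1_(\bigcup_(k < n) F k))).
  elim: n => [|n IH].
    rewrite bigcup_mkord big_ord0; exact: oscillation_set0.
  apply: vanishes_at0_le (vanishes_at0D IH (F0 n)) _ => z.
  by rewrite bigcup_mkord big_ord_recr /= -bigcup_mkord; exact: oscillation_setU.
apply: vanishes_at0_approx => e e0.
(* Bound for the tail before and after translation. *)
pose K := expR a ^+ d + 1.
have K0 : 0 < K by rewrite ltr_wpDl// exprn_ge0// expR_ge0.
have [n Hn] := wint_tail_cvg0 mF (divr_gt0 e0 K0).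
exists (oscillation (\1_(\bigcup_(k < n) F k))) => // z z1.
set A := \bigcup_k F k; set B := \bigcup_(k < n) F k.
have mA : measurable A by exact: bigcupT_measurable.
have mB : measurable B by exact: mU.
have mD : measurable (A `\` B) by exact: measurableD.
have bA := bounded_by_indic mA; have bB := bounded_by_indic mB.
have bD := bounded_by_indic mD.
have oB := bounded_by_oscillation z bB.
have bDz := bounded_by_shift z bD.
have D0 x : 0 <= \1_(A `\` B) x :> R by rewrite indicE.
apply: (@le_trans _ _ (oscillation (\1_B) z +
    (wint a (fun x => \1_(A `\` B) (x + z)) + wint a (\1_(A `\` B))))).
  rewrite -(wintD a_gt0 bDz bD) /oscillation -(wintD a_gt0 oB (bounded_byD bDz bD)).
  apply: (le_wint a_gt0).
  - exact: bounded_by_oscillation bA.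
  - exact: bounded_byD oB (bounded_byD bDz bD).
  have BA : B `<=` A by move=> x [k _ Fk]; exists k.
  have indA x : \1_A x = \1_B x + \1_(A `\` B) x :> R.
    rewrite !indicE; have [xB|xB] := boolP (x \in B).
      rewrite (mem_set (BA _ (set_mem xB))) memNset ?addr0// => -[_]; apply.
      exact: set_mem.
    rewrite add0r; congr (_%:R); congr nat_of_bool; apply/idP/idP => [/set_mem xA|/set_mem[xA _]].
      by apply: mem_set; split => //; move=> /mem_set; apply/negP.
    exact: mem_set.
  move=> x; rewrite !indA.
  set u := \1_B (x + z); set v := \1_B x; set s := \1_(_ `\` _) (x + z); set t := \1_(_ `\` _) x.
  have -> : u + s - (v + t) = (u - v) + (s - t) by ring.
  rewrite (le_trans (ler_normD _ _))// lerD2l (le_trans (ler_normB _ _))//.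
  by rewrite !ger0_norm.
rewrite lerD2l; apply: (@le_trans _ _ (K * (e / K))); last first.
  by rewrite mulrCA divff ?gt_eqF// mulr1.
rewrite /K mulrDl mul1r lerD//.
apply: (le_trans (wint_shift a_gt0 bD D0 z1)).
by rewrite ler_wpM2l ?exprn_ge0 ?expR_ge0.
Qed.

(** The oscillation is subadditive under unions and invariant under complements, so
    the sets with this property form a sigma-algebra; it contains the half-spaces. *)
Lemma oscillation_measurable A : measurable A -> vanishes_at0 (oscillation (\1_A)).
Proof.
move=> mA.
pose good := [set B : set 'rV[R]_d | measurable B /\ vanishes_at0 (oscillation (\1_B))].
have good0 : good set0.
  by split => //; exact: oscillation_set0.
have goodC B : good B -> good (~` B).
  move=> [mB B0]; split; first exact: measurableC.
  by rewrite oscillation_setC.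
have goodU (F : (set 'rV[R]_d)^nat) : (forall k, good (F k)) -> good (\bigcup_k F k).
  move=> gF; split; first by apply: bigcupT_measurable => k; have [] := gF k.
  by apply: oscillation_bigcup => k; have [] := gF k.
suff [] : good A by [].
apply: (mA good); split; first by split => //= B gB; rewrite setTD; exact: goodC.
move=> B; rewrite -bigcup_seq => -[i _ [C mC <-]] /=; rewrite setTI.
move: C mC.
rewrite -[measurable]/((@ocitv R).-sigma.-measurable) RGenOInfty.measurableE.
move=> C mC; apply: (mC [set C' | good ((fun x : 'rV[R]_d => x ord0 i) @^-1` C')]); split.
  split => /=.
  - by rewrite preimage_set0.
  - by move=> B' gB'; rewrite setTD preimage_setC; exact: goodC.
  - by move=> F gF; rewrite preimage_bigcup; exact: goodU.
move=> _ [c ->] /=.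
(* The Borel sets of the line are generated by open half-lines. *)
suff H : good [set x | c < x ord0 i].
  move: H; congr good; apply/seteqP.
  by split => x /=; rewrite in_itv/= andbT.
split; last exact: oscillation_halfspace.
have := @measurable_coord_rV _ R d i measurableT `]c, +oo[%classic (measurable_itv _).
rewrite setTI; congr measurable; apply/seteqP; split => x /=; by rewrite in_itv/= andbT.
Qed.

(** Layer-cake approximation at mesh eta: s is counted by the levels k eta below it. *)
Lemma step_approximation (eta s : R) (K : nat) : 0 < eta -> 0 <= s -> s <= K%:R * eta ->
  s <= eta * (\sum_(k < K) (k%:R * eta < s)%R%:R) <= s + eta.
Proof.
move=> eta0 s0 sK.
have Hlt J : J%:R * eta < s -> \sum_(k < J) ((k%:R * eta < s)%R%:R : R) = J%:R.
  move=> Js; rewrite (eq_bigr (fun=> 1)).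
    by rewrite sumr_const card_ord.
  move=> k _; rewrite (_ : _ < _)//; apply: le_lt_trans Js.
  by rewrite ler_wpM2r ?(ltW eta0)// ler_nat ltnW.
elim: K sK => [|K IH] sK.
  by move: sK; rewrite big_ord0 mulr0 mul0r => ->; rewrite addr_ge0// ltW.
rewrite big_ord_recr/=; have [Ks|sK'] := ltP (K%:R * eta) s; last by rewrite addr0; exact: IH.
rewrite Hlt//; move: sK Ks; rewrite -natr1 => sK Ks.
by rewrite (_ : true%:R = 1)//; apply/andP; split; lra.
Qed.

(** Translations are continuous in L^1(psi_a) on bounded measurable functions: up
    to an error eta, such a function is eta times a finite sum of indicators of
    its superlevel sets. *)
Lemma oscillation_bounded M q : bounded_by M q -> vanishes_at0 (oscillation q).
Proof.
move=> qM; have [mq qMx] := qM.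
have M0 : 0 <= M by exact: le_trans (qMx 0).
pose m := wint a (fun _ : 'rV[R]_d => 1).
have m0 : 0 <= m by exact: wint_ge0.
apply: vanishes_at0_approx => e e0.
have m1 : 0 < m + 1 by rewrite ltr_wpDl.
pose eta := e / (m + 1).
have eta0 : 0 < eta by exact: divr_gt0.
pose K := (Num.truncn ((M + M) / eta)).+1.
pose A k := [set x | k%:R * eta < q x + M].
have mA k : measurable (A k).
  have := mq measurableT `](k%:R * eta - M), +oo[%classic (measurable_itv _).
  rewrite setTI; congr measurable; apply/seteqP.
  by split => x /=; rewrite in_itv/= andbT ltrBlDr.
have oA k z := bounded_by_oscillation z (bounded_by_indic (mA k)).
exists (fun z => eta * \sum_(k < K) oscillation (\1_(A k)) z).
  apply: vanishes_at0Z; first exact: ltW.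
  apply: (@vanishes_at0_sum K (fun k => oscillation (\1_(A k)))) => k.
  exact: oscillation_measurable.
move=> z _.
have bS J : bounded_by (J%:R * (1 + 1))
    (fun x => \sum_(k < J) `|\1_(A k) (x + z) - \1_(A k) x|).
  elim: J => [|J IH].
    rewrite mul0r; under eq_fun do rewrite big_ord0.
    by have := @bounded_by_cst R d 0; rewrite normr0.
  rewrite -natr1 mulrDl mul1r.
  by under eq_fun do rewrite big_ord_recr; exact: bounded_byD.
have wS J : wint a (fun x => \sum_(k < J) `|\1_(A k) (x + z) - \1_(A k) x|) =
    \sum_(k < J) oscillation (\1_(A k)) z.
  elim: J => [|J IH].
    rewrite big_ord0 /wint (@eq_Rintegral _ _ _ _ _ (fun=> 0)).
      by rewrite Rintegral_cst// mul0r.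
    by move=> x _; rewrite big_ord0 mul0r.
  rewrite big_ord_recr/= -IH -(wintD a_gt0 (bS J) (oA J z)).
  by congr wint; apply/funext => x; rewrite big_ord_recr.
have b1 := @bounded_by_cst R d 1.
have beta := bounded_byM (bounded_by_cst eta) b1.
have bbS := bounded_byM (bounded_by_cst eta) (bS K).
apply: (@le_trans _ _ (eta * (\sum_(k < K) oscillation (\1_(A k)) z) + eta * m)); last first.
  by rewrite lerD2l /eta -mulrA ger_pMr// ler_pdivrMl// mulr1 lerDl.
rewrite -wS -(wintZ a_gt0 _ (bS K)) -(wintZ a_gt0 _ b1) -(wintD a_gt0 bbS beta).
apply: (le_wint a_gt0 (bounded_by_oscillation z qM) (bounded_byD bbS beta)) => x.
have approx y : q y + M <= eta * (\sum_(k < K) \1_(A k) y) <= q y + M + eta.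
  have /andP[y1 y2] : - M <= q y <= M by rewrite -ler_norml.
  have -> : \sum_(k < K) \1_(A k) y = \sum_(k < K) ((k%:R * eta < q y + M)%R%:R : R).
    apply: eq_bigr => k _; rewrite indicE; congr (_%:R); congr nat_of_bool.
    by apply/idP/idP => [/set_mem|] //; exact: mem_set.
  apply: step_approximation => //; first by lra.
  rewrite -ler_pdivrMr//; apply: (@le_trans _ _ ((M + M) / eta)).
    by rewrite ler_wpM2r ?invr_ge0 ?(ltW eta0)//; lra.
  exact/ltW/truncnS_gt.
have /andP[x1 x2] := approx x; have /andP[z1 z2] := approx (x + z).
rewrite mulr1; set T := \sum_(k < K) `| _ |.
have TT : `|\sum_(k < K) \1_(A k) (x + z) - \sum_(k < K) \1_(A k) x| <= T.
  by rewrite -sumrB; exact: ler_norm_sum.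
have : eta * `|\sum_(k < K) \1_(A k) (x + z) - \sum_(k < K) \1_(A k) x| <= eta * T.
  by rewrite ler_pM2l.
rewrite -{1}(gtr0_norm eta0) -normrM mulrBr.
move: (eta * _) (eta * _) (eta * T) x1 x2 z1 z2 => p r t x1 x2 z1 z2.
rewrite !ler_norml => /andP[h1 h2]; apply/andP; split; lra.
Qed.

End translation_continuity.

(** * Convolution with integrable kernels *)

Section convolution.
Context {R : realType} {d : nat}.
Local Notation mu := (lebesgue_rV R d).
Implicit Types (q f g k : 'rV[R]_d -> R) (x y z : 'rV[R]_d).

(** Domination by the weight psi_1 stands for an integrable kernel; it is stable
    under sums and bounded translations, and gives a quantitative bound on the
    convolution ([convol_bound]). *)
Definition dominated_kernel (C : R) k : Prop :=
  measurable_fun setT k /\ forall z, `|k z| <= C * weight 1 z.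

(** The kernel is evaluated at y - x rather than x - y: as a function of y it is
    then a translate of k, which avoids reflections. *)
Definition convol k q x : R := \int[mu]_y (q y * k (y - x)).

Lemma dominated_kernel_box (r C : R) k : 0 <= r -> measurable_fun setT k ->
  (forall z, `|k z| <= C) -> (forall z i, r < `|z ord0 i| -> k z = 0) ->
  dominated_kernel (C * expR r ^+ d) k.
Proof.
move=> r0 mk kC kr; split => // z.
have C0 : 0 <= C by exact: le_trans (kC z).
have [[i zi]|zr] := pselect (exists i, r < `|z ord0 i|).
  by rewrite (kr _ _ zi) normr0 !mulr_ge0 ?exprn_ge0 ?expR_ge0 ?weight_ge0.
rewrite (le_trans (kC z))// -mulrA ler_peMr//.
rewrite /weight /prod_coord -[X in _ ^+ X]card_ord -prodr_const -big_split/=.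
elim/big_ind : _ => [//|*|i _]; first exact: mulr_ege1.
rewrite /exp_decay mul1r -expRD -[leLHS]expR0 ler_expR subr_ge0.
by rewrite leNgt; apply/negP => zi; apply: zr; exists i.
Qed.

Lemma dominated_kernelD C D f k : dominated_kernel C f -> dominated_kernel D k ->
  dominated_kernel (C + D) (fun z => f z + k z).
Proof.
move=> [mf fC] [mk kD]; split; first exact: measurable_funD.
by move=> z; rewrite mulrDl (le_trans (ler_normD _ _))// lerD.
Qed.

Lemma dominated_kernelZ C k (c : R) : dominated_kernel C k ->
  dominated_kernel (`|c| * C) (fun z => c * k z).
Proof.
move=> [mk kC]; split; first exact: measurable_funM.
by move=> z; rewrite normrM -mulrA ler_wpM2l.
Qed.

Lemma measurable_shift k z : measurable_fun setT k -> measurable_fun setT (fun y => k (y + z)).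
Proof. by move=> mk; apply: (measurableT_comp mk); exact: measurable_addr_rV. Qed.

Lemma integrable_convol M C k q x : bounded_by M q -> dominated_kernel C k ->
  mu.-integrable setT (EFin \o (fun y => q y * k (y - x))).
Proof.
move=> [mq qM] [mk kC].
have M0 : 0 <= M by exact: le_trans (qM 0).
have mkx := measurable_shift (- x) mk.
apply/integrableP; split; first by apply/measurable_EFinP; exact: measurable_funM.
have mw : measurable_fun setT (fun y => (M * C * weight 1 (y - x))%:E).
  apply/measurable_EFinP; apply: measurable_funM => //.
  exact: (measurable_shift (- x) (measurable_weight 1)).
apply: (@le_lt_trans _ _ (\int[mu]_y (M * C * weight 1 (y - x))%:E)%E).
  apply: ge0_le_integral => //.
  - by apply: measurableT_comp => //; apply/measurable_EFinP; exact: measurable_funM.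
  - move=> y _; rewrite abse_EFin lee_fin normrM -mulrA.
    by rewrite ler_pM.
have C0 : 0 <= C by have := le_trans (normr_ge0 _) (kC 0); rewrite pmulr_lge0// weight_gt0.
rewrite (ge0_integral_translation (f := fun y => (M * C * weight 1 y)%:E)); last 2 first.
- by apply/measurable_EFinP; apply: measurable_funM => //; exact: measurable_weight.
- by move=> y; rewrite lee_fin !mulr_ge0 ?weight_ge0.
under eq_integral do rewrite EFinM.
rewrite ge0_integralZl//; last 3 first.
- by apply/measurable_EFinP; exact: measurable_weight.
- by move=> y _; rewrite lee_fin weight_ge0.
- by rewrite lee_fin mulr_ge0.
rewrite lte_mul_pinfty// ?lee_fin ?mulr_ge0//.
exact: ge0_integral_weight.
Qed.

Lemma convol_bound M C k q x : bounded_by M q -> dominated_kernel C k ->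
  `|convol k q x| <= M * C * wint 1 (fun _ : 'rV[R]_d => 1).
Proof.
move=> qM kC; have [mq qMx] := qM; have [mk kCx] := kC.
have M0 : 0 <= M by exact: le_trans (qMx 0).
have C0 : 0 <= C by have := le_trans (normr_ge0 _) (kCx 0); rewrite pmulr_lge0// weight_gt0.
have iq := integrable_convol x qM kC.
have iw := integrable_convol x (bounded_by_cst (M * C))
  (_ : dominated_kernel 1 (weight 1)).
rewrite /convol (le_trans (le_normr_Rintegral _ iq))//.
apply: (@le_trans _ _ (\int[mu]_y (M * C * weight 1 (y - x)))).
  apply: le_Rintegral => //; first exact: integrable_norm iq.
    apply: iw; split; first exact: measurable_weight.
    by move=> z; rewrite mul1r ger0_norm// weight_ge0.
  by move=> y _; rewrite normrM -mulrA ler_pM.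
rewrite (Rintegral_translation (f := fun y => M * C * weight 1 y)); last 2 first.
- by apply: measurable_funM => //; exact: measurable_weight.
- by move=> y; rewrite !mulr_ge0 ?weight_ge0.
rewrite -(wintZ ltr01 _ (@bounded_by_cst R d 1)).
by rewrite /wint le_eqVlt; apply/orP; left; apply/eqP/eq_Rintegral => y _; rewrite mulr1.
Qed.

Lemma convolD M C D f k q x : bounded_by M q -> dominated_kernel C f -> dominated_kernel D k ->
  convol (fun z => f z + k z) q x = convol f q x + convol k q x.
Proof.
move=> qM fC kD; rewrite /convol -RintegralD//;
  [|exact: integrable_convol qM fC|exact: integrable_convol qM kD].
by apply: eq_Rintegral => y _; rewrite mulrDr.
Qed.

Lemma convolZ M C k q (c : R) x : bounded_by M q -> dominated_kernel C k ->
  convol (fun z => c * k z) q x = c * convol k q x.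
Proof.
move=> qM kC; rewrite /convol -RintegralZl//; last exact: integrable_convol qM kC.
by apply: eq_Rintegral => y _; rewrite mulrCA.
Qed.

Lemma convol_shift k q x z : convol k q (x + z) = convol (fun y => k (y - z)) q x.
Proof. by apply: eq_Rintegral => y _; rewrite opprD addrA. Qed.

End convolution.

(** * Mollification *)

Section mollification.
Context {R : realType} {d : nat}.
Local Notation mu := (lebesgue_rV R d).
Implicit Types (q f g k : 'rV[R]_d -> R) (x y z : 'rV[R]_d).

Variables (b : nat -> R -> R) (r : R).
Hypotheses (r_gt0 : 0 < r) (tb : derivative_tower b)
  (bout : forall m s, r <= `|s| -> b m s = 0) (b_ge0 : forall s, 0 <= b 0%N s)
  (b_int : (\int[lebesgue_measure]_s (b 0%N s)%:E = 1)%E).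

(** Here b 0 is a one-dimensional mollifier and b m its m-th derivative; [moll_lap]
    is the Laplacian of the product mollifier ([test_function_moll]). *)
Definition moll : 'rV[R]_d -> R := prod_coord (fun _ => b 0%N).

Definition moll_lap : 'rV[R]_d -> R :=
  fun z => \sum_j prod_coord (fun i => b (if i == j then 2 else 0)%N) z.

Lemma measurable_tower m : measurable_fun setT (b m).
Proof. by apply: continuous_measurable_fun; exact: derivative_tower_continuous. Qed.

Lemma dominated_tower_prod (e : 'I_d -> nat) :
  exists C, dominated_kernel C (prod_coord (fun i => b (e i))).
Proof.
have H i : exists K, 0 <= K /\ forall s, `|b (e i) s| <= K.
  by have [K K0 bK] := derivative_tower_bounded (ltW r_gt0) tb bout (e i); exists K.
have /choice[K HK] := H.
exists ((\prod_i K i) * expR r ^+ d); apply: dominated_kernel_box; first exact: ltW.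
- by apply: measurable_prod_coord => i; exact: measurable_tower.
- move=> z; rewrite /prod_coord normr_prod; apply: ler_prod => i _.
  by rewrite normr_ge0/=; have [_] := HK i.
- by move=> z i zi; rewrite /prod_coord (bigD1 i)//= bout ?mul0r// ltW.
Qed.

Lemma dominated_kernel_sum n (f : 'I_n -> 'rV[R]_d -> R) :
  (forall j, exists C, dominated_kernel C (f j)) ->
  exists C, dominated_kernel C (fun z => \sum_j f j z).
Proof.
elim: n f => [|n IH] f H.
  exists 0; split; first by under eq_fun do rewrite big_ord0; exact: measurable_cst.
  by move=> z; rewrite big_ord0 normr0 mul0r.
have [C HC] := H ord0; have [D HD] := IH _ (fun j => H (lift ord0 j)).
exists (C + D); under eq_fun do rewrite big_ord_recl; exact: dominated_kernelD.
Qed.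

Lemma dominated_moll : exists C, dominated_kernel C moll.
Proof. exact: (dominated_tower_prod (fun=> 0%N)). Qed.

Lemma dominated_moll_lap : exists C, dominated_kernel C moll_lap.
Proof. by apply: dominated_kernel_sum => j; exact: dominated_tower_prod. Qed.

Lemma moll_ge0 z : 0 <= moll z.
Proof. exact: prodr_ge0. Qed.

Lemma measurable_moll : measurable_fun setT moll.
Proof. by apply: measurable_prod_coord => i; exact: measurable_tower. Qed.

Lemma moll_out z i : r < `|z ord0 i| -> moll z = 0.
Proof. by move=> zi; rewrite /moll /prod_coord (bigD1 i)//= bout ?mul0r// ltW. Qed.

Lemma integral_moll : (\int[mu]_z (moll z)%:E = 1)%E.
Proof.
rewrite /moll ge0_integral_prod_coord//; last by move=> i; exact: measurable_tower.
by rewrite big1.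
Qed.

Lemma Rintegral_moll_shift x : \int[mu]_y moll (y - x) = 1.
Proof.
rewrite (Rintegral_translation _ measurable_moll moll_ge0).
by rewrite /Rintegral integral_moll.
Qed.

Lemma convol_cst (c : R) x : convol moll (fun=> c) x = c.
Proof.
have [C HC] := dominated_moll.
rewrite -[RHS]mulr1 -(Rintegral_moll_shift x) /convol RintegralZl//.
have := integrable_convol x (bounded_by_cst 1) HC.
by apply: eq_integrable => // y _ /=; rewrite mul1r.
Qed.

Lemma le_convol M N q f x : bounded_by M q -> bounded_by N f -> (forall y, q y <= f y) ->
  convol moll q x <= convol moll f x.
Proof.
move=> qM fN qf; have [C HC] := dominated_moll.
apply: le_Rintegral => //; [exact: integrable_convol qM HC|exact: integrable_convol fN HC|].
by move=> y _; rewrite ler_wpM2r// moll_ge0.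
Qed.

(** Measurability comes from Tonelli, which applies after adding the constant M to
    make q nonnegative. *)
Lemma bounded_by_convol M q : bounded_by M q -> bounded_by M (convol moll q).
Proof.
move=> qM; have [mq qMx] := qM; have [C HC] := dominated_moll.
have M0 : 0 <= M by exact: le_trans (qMx 0).
have cM := @bounded_by_cst R d M; have cNM := @bounded_by_cst R d (- M).
split; last first.
  move=> x; rewrite ler_norml -{1}(convol_cst (- M) x) -{2}(convol_cst M x).
  by apply/andP; split; [apply: le_convol cNM qM _|apply: le_convol qM cM _] => y;
    have := qMx y; rewrite ler_norml => /andP[].
(* Shifted to be nonnegative. *)
pose q' y := q y + M.
have q'M := bounded_byD qM cM.
have q'0 y : 0 <= q' y by have := qMx y; rewrite ler_norml /q' => /andP[? ?]; lra.
have e x : convol moll q x = fine (\int[mu]_y (q' y * moll (y - x))%:E) - M.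
  rewrite -[in RHS](convol_cst M x) -[fine _]/(convol moll q' x) /convol -RintegralB//.
  - by apply: eq_Rintegral => y _; rewrite -mulrBl /q' addrK.
  - exact: integrable_convol q'M HC.
  - exact: integrable_convol cM HC.
rewrite (_ : convol moll q = fun x => fine (\int[mu]_y (q' y * moll (y - x))%:E) - M); last first.
  exact/funext.
apply: measurable_funB => //; apply: measurableT_comp => //.
apply: (measurable_fun_fubini_tonelli_F
  (fun xy : 'rV[R]_d * 'rV[R]_d => (q' xy.2 * moll (xy.2 - xy.1))%:E)).
- apply/measurable_EFinP; apply: measurable_funM.
    have [mq' _] := q'M; exact: measurableT_comp.
  apply: (measurableT_comp measurable_moll).
  apply: measurable_fun_rVP => i.
  rewrite (_ : (fun _ => _) = (fun xy : 'rV[R]_d * 'rV[R]_d => xy.2 ord0 i - xy.1 ord0 i)).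
    apply: measurable_funB; apply: (measurableT_comp (measurable_coord_rV i)) => //.
  by apply/funext => xy; rewrite !mxE.
- by move=> [x y]; rewrite lee_fin mulr_ge0// moll_ge0.
Qed.

Lemma test_function_moll x : test_function (fun y => moll (y - x)) /\
  laplacian (fun y => moll (y - x)) = fun y => moll_lap (y - x).
Proof.
pose F i (m : nat) s := b m (s - x ord0 i).
have tF i : derivative_tower (F i).
  have := derivative_tower_affine 1 (- x ord0 i) 1 tb.
  congr derivative_tower; apply/funext => m; apply/funext => s.
  by rewrite /F expr1n !mul1r.
have e : (fun y => moll (y - x)) = prod_coord (fun i => F i 0%N).
  by apply/funext => y; apply: eq_bigr => i _; rewrite /F !mxE.
rewrite e; split.
  by apply: (@test_function_prod_coord _ _ F (fun i => x ord0 i) r) => // i s; exact: bout.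
rewrite laplacian_prod_coord//; apply/funext => y; apply: eq_bigr => j _.
by apply: eq_bigr => i _; rewrite /F !mxE.
Qed.

(** By Tonelli, the left-hand side is at most the average of the oscillations of q
    at the points z, weighted by the mollifier, and only |z_i| <= r matter. *)
Lemma convol_approx (a e M : R) q : 0 < a -> bounded_by M q ->
  (forall z, (forall i, `|z ord0 i| <= r) -> oscillation a q z <= e) ->
  wint a (fun x => `|convol moll q x - q x|) <= e.
Proof.
move=> a0 qM osc; have [mq qMx] := qM; have [C HC] := dominated_moll.
have M0 : 0 <= M by exact: le_trans (qMx 0).
(* The integrand on the product space, integrated in both orders. *)
pose G (xz : 'rV[R]_d * 'rV[R]_d) : R :=
  `|q (xz.1 + xz.2) - q xz.1| * moll xz.2 * weight a xz.1.
have G0 xz : 0 <= G xz by rewrite !mulr_ge0 ?moll_ge0 ?weight_ge0.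
have mG : measurable_fun setT G.
  apply: measurable_funM; last by apply: (measurableT_comp (measurable_weight a)).
  apply: measurable_funM; last by apply: (measurableT_comp measurable_moll).
  apply: measurableT_comp => //; apply: measurable_funB; last exact: measurableT_comp.
  apply: (measurableT_comp mq); apply: measurable_fun_rVP => i.
  rewrite (_ : (fun _ => _) = (fun xy : 'rV[R]_d * 'rV[R]_d => xy.1 ord0 i + xy.2 ord0 i)).
    by apply: measurable_funD; apply: (measurableT_comp (measurable_coord_rV i)).
  by apply/funext => xy; rewrite !mxE.
have bc := bounded_by_norm (bounded_byB (bounded_by_convol qM) qM).
have pt x : `|convol moll q x - q x| <= \int[mu]_z (`|q (x + z) - q x| * moll z).
  have cq := @bounded_by_cst R d (q x).
  have bq := bounded_byB qM cq.
  rewrite -[q x in X in `|X|](convol_cst (q x) x) /convol -RintegralB//;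
    [|exact: integrable_convol qM HC|exact: integrable_convol cq HC].
  rewrite (@eq_Rintegral _ _ _ _ _ (fun y => (q y - q x) * moll (y - x))); last first.
    by move=> y _; rewrite mulrBl.
  apply: (le_trans (le_normr_Rintegral _ (integrable_convol x bq HC))) => //.
  rewrite -[leRHS](Rintegral_translation (- x)).
  - rewrite le_eqVlt; apply/orP; left; apply/eqP/eq_Rintegral => y _.
    by rewrite normrM (ger0_norm (moll_ge0 _)) (addrC x) subrK.
  - apply: measurable_funM; last exact: measurable_moll.
    apply: measurableT_comp => //; apply: measurable_funB => //.
    rewrite (_ : (fun z => q (x + z)) = (fun z => q (z + x))); last first.
      by apply/funext => z; rewrite addrC.
    exact: measurable_shift.
  - by move=> z; rewrite mulr_ge0 ?moll_ge0.
have intz x : mu.-integrable setT (EFin \o (fun z => `|q (x + z) - q x| * moll z)).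
  have cq := @bounded_by_cst R d (q x).
  have := integrable_convol 0 (bounded_by_norm (bounded_byB (bounded_by_shift x qM) cq)) HC.
  by apply: eq_integrable => // z _ /=; rewrite subr0 (addrC x).
rewrite -lee_fin /wint /Rintegral fineK; last first.
  by apply: integrable_fin_num => //; exact: integrable_weight bc.
apply: (@le_trans _ _ (\int[mu]_x \int[mu]_z (G (x, z))%:E)%E).
  apply: ge0_le_integral => //.
  - by move=> x _; rewrite lee_fin mulr_ge0 ?weight_ge0.
  - have [mbc _] := bc; apply/measurable_EFinP; apply: measurable_funM => //.
    exact: measurable_weight.
  - apply: (measurable_fun_fubini_tonelli_F (EFin \o G)) => //.
    exact/measurable_EFinP.
  - move=> x _; apply: (@le_trans _ _
        (\int[mu]_z (`|q (x + z) - q x| * moll z)%:E * (weight a x)%:E)%E).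
      rewrite EFinM lee_wpmul2r ?lee_fin ?weight_ge0//.
      rewrite -(@fineK _ (\int[mu]_z _)%E) ?lee_fin; first exact: pt.
      exact: (integrable_fin_num measurableT (intz x)).
    by rewrite -integralZr//; exact: intz.
rewrite (fubini_tonelli (EFin \o G))//; last exact/measurable_EFinP.
apply: (@le_trans _ _ (\int[mu]_z (e%:E * (moll z)%:E))%E).
  apply: ge0_le_integral => //.
  - by move=> z _; apply: integral_ge0 => x _; rewrite lee_fin.
  - apply: (measurable_fun_fubini_tonelli_G (EFin \o G)) => //.
    exact/measurable_EFinP.
  - by apply: measurable_funeM; apply/measurable_EFinP; exact: measurable_moll.
  - move=> z _.
    have [[i zi]|zr] := pselect (exists i, r < `|z ord0 i|).
      rewrite (moll_out zi) mule0 integral0_eq// => x _.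
      by rewrite /G /= (moll_out zi) mulr0 mul0r.
    have zr' i : `|z ord0 i| <= r by rewrite leNgt; apply/negP => zi; apply: zr; exists i.
    have io := integrable_weight a0 (bounded_by_oscillation z qM).
    rewrite [leLHS](_ : _ = (moll z)%:E * \int[mu]_x (`|q (x + z) - q x| * weight a x)%:E)%E.
      rewrite muleC lee_wpmul2r ?lee_fin ?moll_ge0//.
      rewrite -(@fineK _ (\int[mu]_x _)%E) ?lee_fin; first exact: osc.
      exact: (integrable_fin_num measurableT io).
    rewrite -integralZl//; apply: eq_integral => x _.
    by rewrite /= -EFinM /G /=; congr (_%:E); rewrite mulrAC mulrC.
rewrite ge0_integralZl//; last 3 first.
- by apply/measurable_EFinP; exact: measurable_moll.
- by move=> z _; rewrite lee_fin moll_ge0.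
- rewrite lee_fin (le_trans _ (osc 0 _))//; first exact: wint_ge0.
  by move=> i; rewrite mxE normr0 ltW.
by rewrite integral_moll mule1.
Qed.

End mollification.

(** * The Kato inequality *)

Section second_difference_kernel.
Context {R : realType} {d : nat}.
Implicit Types (x y z : 'rV[R]_d).

Variables (b : nat -> R -> R) (r : R).
Hypotheses (r_gt0 : 0 < r) (tb : derivative_tower b)
  (bout : forall m s, r <= `|s| -> b m s = 0).

(** The discrete Laplacian of the mollifier at scale h, minus h^2 times its
    Laplacian. *)
Definition lap_error (h : R) z : R :=
  \sum_j (moll b (z - h *: delta_mx ord0 j) + moll b (z + h *: delta_mx ord0 j)
    - 2 * moll b z) - h ^+ 2 * moll_lap b z.

(** In each direction only one factor of the product varies, so the error is the
    one-dimensional one of order h^3 times bounded factors; one order better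
    than the h^2 by which it will be divided. *)
Lemma lap_error_kernel : exists2 C, 0 <= C &
  forall h, 0 <= h <= 1 -> dominated_kernel (C * h ^+ 3) (lap_error h : 'rV[R]_d -> R).
Proof.
have [K0 K00 bK0] := derivative_tower_bounded (ltW r_gt0) tb bout 0%N.
have [K3 K30 bK3] := derivative_tower_bounded (ltW r_gt0) tb bout 3%N.
pose C0 := d%:R * (2 * K3 * K0 ^+ d.-1).
have C00 : 0 <= C0 by rewrite /C0 !mulr_ge0 ?exprn_ge0.
exists (C0 * expR (r + 1) ^+ d); first by rewrite mulr_ge0// exprn_ge0// expR_ge0.
move=> h /andP[h0 h1].
have mm := @measurable_moll R d b tb.
have e z : lap_error h z = \sum_j (b 0%N (z ord0 j + h) + b 0%N (z ord0 j - h)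
    - 2 * b 0%N (z ord0 j) - h ^+ 2 * b 2%N (z ord0 j)) * \prod_(i | i != j) b 0%N (z ord0 i).
  rewrite /lap_error /moll_lap mulr_sumr -sumrB; apply: eq_bigr => j _.
  pose P := \prod_(i | i != j) b 0%N (z ord0 i).
  have e0 : moll b z = b 0%N (z ord0 j) * P by rewrite /moll /prod_coord (bigD1 j).
  have e2 : prod_coord (fun i => b (if i == j then 2 else 0)%N) z = b 2%N (z ord0 j) * P.
    rewrite /prod_coord (bigD1 j)//= eqxx; congr (_ * _).
    by apply: eq_bigr => i /negbTE ->.
  by rewrite e0 e2 /moll -scaleNr !prod_coord_shift -/P; ring.
rewrite (mulrAC C0); apply: dominated_kernel_box.
- by rewrite addr_ge0// ltW.
- apply: measurable_funB; last first.
    apply: measurable_funM => //.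
    by have [C [mC _]] := @dominated_moll_lap R d b r r_gt0 tb bout.
  apply: measurable_sum => j; apply: measurable_funB.
    by apply: measurable_funD; exact: measurable_shift mm.
  exact: measurable_funM.
- move=> z; rewrite e (le_trans (ler_norm_sum _ _ _))//.
  apply: (@le_trans _ _ (\sum_(j < d) (2 * K3 * h ^+ 3 * K0 ^+ d.-1))).
    apply: ler_sum => j _; rewrite normrM ler_pM//.
      exact: second_difference_bound.
    rewrite normr_prod -[X in _ ^+ X.-1]card_ord -(cardC1 j) -prodr_const.
    by apply: ler_prod => i _; rewrite normr_ge0 bK0.
  rewrite sumr_const card_ord -mulr_natl /C0.
  by rewrite le_eqVlt; apply/orP; left; apply/eqP; ring.
- move=> z i zi; rewrite e big1// => j _.
  have hh : `|h| <= 1 by rewrite ger0_norm.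
  have [ij|ij] := eqVneq j i; last first.
    have bz : b 0%N (z ord0 i) = 0.
      by apply: bout; apply: ltW; apply: lt_trans zi; rewrite ltrDl.
    by rewrite (bigD1 i) ?(eq_sym i)//= bz mul0r mulr0.
  rewrite ij !bout; first by rewrite !mulr0 addr0 !subr0 mul0r.
  + by apply: ltW; apply: lt_trans zi; rewrite ltrDl.
  + by apply: ltW; apply: lt_trans zi; rewrite ltrDl.
  + have := lerB_normD (z ord0 i) (- h); rewrite normrN; lra.
  + have := lerB_normD (z ord0 i) h; lra.
Qed.

End second_difference_kernel.

Section kato.
Context {R : realType} {d : nat}.
Local Notation mu := (lebesgue_rV R d).
Implicit Types (q f g k : 'rV[R]_d -> R) (x y z : 'rV[R]_d).

(** Testing only with integrable phi and Laplacian phi makes integration against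
    bounded functions meaningful, and mollifiers qualify. *)
Definition weak_laplacian w g : Prop := forall phi, test_function phi ->
  mu.-integrable setT (EFin \o phi) -> mu.-integrable setT (EFin \o laplacian phi) ->
  \int[mu]_y (w y * laplacian phi y) = \int[mu]_y (g y * phi y).

(** A convex function B with a subgradient B', together with the bounds and
    Lipschitz constants on [-M, M] that let mollifications be removed. *)
Record convex_entropy (M L : R) (B B' : R -> R) : Prop := {
  entropy_ge0 : forall s, 0 <= B s;
  entropy_convex : forall s t, B' s * (t - s) <= B t - B s;
  entropy_meas : measurable_fun setT B;
  entropy_meas' : measurable_fun setT B';
  entropy_bound : forall s, `|s| <= M -> `|B s| <= L;
  entropy_bound' : forall s, `|s| <= M -> `|B' s| <= L;
  entropy_lip : forall s t, `|s| <= M -> `|t| <= M -> `|B s - B t| <= L * `|s - t|;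
  entropy_lip' : forall s t, `|s| <= M -> `|t| <= M -> `|B' s - B' t| <= L * `|s - t| }.

Lemma bounded_by_comp M L (F : R -> R) q : measurable_fun setT F ->
  (forall s, `|s| <= M -> `|F s| <= L) -> bounded_by M q -> bounded_by L (F \o q).
Proof.
move=> mF FL [mq qM]; split; first exact: measurableT_comp.
by move=> x /=; exact: FL.
Qed.

Lemma bounded_by_sum n (M : R) (F : 'I_n -> 'rV[R]_d -> R) :
  (forall j, bounded_by M (F j)) -> bounded_by (n%:R * M) (fun x => \sum_j F j x).
Proof.
move=> H; split.
  by apply: measurable_sum => j; have [] := H j.
move=> x; rewrite (le_trans (ler_norm_sum _ _ _))//.
rewrite (@le_trans _ _ (\sum_(j < n) M))//; last by rewrite sumr_const card_ord mulr_natl.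
by apply: ler_sum => j _; have [_] := H j.
Qed.

Lemma wint_sum a n (M : R) (F : 'I_n -> 'rV[R]_d -> R) : 0 < a ->
  (forall j, bounded_by M (F j)) ->
  wint a (fun x => \sum_j F j x) = \sum_j wint a (F j).
Proof.
move=> a0; elim: n F => [|n IH] F H.
  rewrite big_ord0 /wint (@eq_Rintegral _ _ _ _ _ (fun=> 0)).
    by rewrite Rintegral_cst// mul0r.
  by move=> x _; rewrite big_ord0 mul0r.
rewrite big_ord_recl -IH// -(wintD a0 (H ord0) (bounded_by_sum (fun j => H (lift ord0 j)))).
by congr wint; apply/funext => x; rewrite big_ord_recl.
Qed.

(** The form in which limits h -> 0 are taken: an error linear in h. *)
Lemma le0_of_linear_bound (A C h1 : R) : 0 < h1 ->
  (forall h, 0 < h <= h1 -> A <= C * h) -> A <= 0.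
Proof.
move=> h10 H; rewrite leNgt; apply/negP => A0.
have C0 : 0 < C.
  have := H h1; rewrite h10 lexx => /(_ isT)/(lt_le_trans A0).
  by rewrite pmulr_lgt0.
pose h := Num.min h1 (A / (2 * C)).
have h0 : 0 < h by rewrite lt_min h10 divr_gt0// mulr_gt0.
have := H h; rewrite h0 ge_min lexx /= => /(_ isT).
apply/negP; rewrite -ltNge; apply: (@le_lt_trans _ _ (C * (A / (2 * C)))).
  by rewrite ler_pM2l// ge_min lexx orbT.
rewrite (_ : C * _ = A / 2); last by field; rewrite gt_eqF.
lra.
Qed.

Lemma convol_sum M q x n (f : 'I_n -> 'rV[R]_d -> R) : bounded_by M q ->
  (forall j, exists C, dominated_kernel C (f j)) ->
  convol (fun z => \sum_j f j z) q x = \sum_j convol (f j) q x.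
Proof.
move=> qM; elim: n f => [|n IH] f H.
  rewrite big_ord0 /convol (@eq_Rintegral _ _ _ _ _ (fun=> 0)).
    by rewrite Rintegral_cst// mul0r.
  by move=> y _; rewrite big_ord0 mulr0.
have [C HC] := H ord0.
have [D HD] := dominated_kernel_sum (fun j => H (lift ord0 j)).
rewrite big_ord_recl -IH// -(convolD _ qM HC HD).
by apply: eq_Rintegral => y _; rewrite big_ord_recl.
Qed.

Lemma dominated_kernel_shift C k z : dominated_kernel C k ->
  (forall i, `|z ord0 i| <= 1) -> dominated_kernel (C * expR 1 ^+ d) (fun y => k (y + z)).
Proof.
move=> [mk kC] z1; split; first exact: measurable_shift.
have C0 : 0 <= C by have := le_trans (normr_ge0 _) (kC 0); rewrite pmulr_lge0// weight_gt0.
move=> y; rewrite (le_trans (kC _))// -mulrA ler_wpM2l//.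
exact: weight_shift.
Qed.

(** The Kato inequality for the mollified function. Convexity is used pointwise
    for second differences, and the Laplacian appears only as their limit. *)
Lemma mollified_kato (a M N L : R) (B B' : R -> R) w g (b : nat -> R -> R) (r : R) :
  0 < a -> bounded_by M w -> bounded_by N g -> weak_laplacian w g ->
  convex_entropy M L B B' ->
  0 < r -> derivative_tower b -> (forall m s, r <= `|s| -> b m s = 0) ->
  (forall s, 0 <= b 0%N s) -> (\int[lebesgue_measure]_s (b 0%N s)%:E = 1)%E ->
  wint a (fun x => B' (convol (moll b) w x) * convol (moll b) g x) <=
  4 * d%:R * a ^+ 2 * wint a (fun x => B (convol (moll b) w x)).
Proof.
move=> a0 wM gN wg [B0 Bc mB mB' BL B'L _ _] r0 tb bout b0 bint.
set W := convol (moll b) w; set V := convol (moll b) g.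
have bW : bounded_by M W by exact: (bounded_by_convol r0 tb bout b0 bint).
have bV : bounded_by N V by exact: (bounded_by_convol r0 tb bout b0 bint).
have bBW := bounded_by_comp mB BL bW.
have bB'W := bounded_by_comp mB' B'L bW.
have [C C0 HC] := @lap_error_kernel R d b r r0 tb bout.
have [D0 HD0] := @dominated_moll R d b r r0 tb bout.
have [D2 HD2] := @dominated_moll_lap R d b r r0 tb bout.
have VE x : V x = convol (moll_lap b) w x.
  (* Test the equation with the mollifier centred at x. *)
  have [tx lx] := test_function_moll tb bout x.
  have := wg _ tx; rewrite lx => /(_ _ _)/esym; apply.
  - have := integrable_convol x (@bounded_by_cst R d 1) HD0.
    by apply: eq_integrable => // y _ /=; rewrite mul1r.
  - have := integrable_convol x (@bounded_by_cst R d 1) HD2.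
    by apply: eq_integrable => // y _ /=; rewrite mul1r.
pose D h x : R := \sum_j (W (x + h *: delta_mx ord0 j) + W (x - h *: delta_mx ord0 j) - 2 * W x).
pose m := wint 1 (fun _ : 'rV[R]_d => 1).
have e1 (h : R) (j : 'I_d) : 0 <= h <= 1 ->
    forall i, `|(h *: delta_mx ord0 j : 'rV[R]_d) ord0 i| <= 1.
  move=> /andP[h0 h1] i; rewrite !mxE normrM ger0_norm//; case: (_ && _).
    by rewrite normr1 mulr1.
  by rewrite normr0 mulr0.
have e1N (h : R) (j : 'I_d) : 0 <= h <= 1 ->
    forall i, `|(- (h *: delta_mx ord0 j) : 'rV[R]_d) ord0 i| <= 1.
  by move=> h01 i; rewrite mxE normrN; exact: e1.
have DE h x : 0 <= h <= 1 -> convol (lap_error b h) w x = D h x - h ^+ 2 * V x.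
  move=> h01.
  have k1 j := dominated_kernel_shift HD0 (e1N h j h01).
  have k2 j := dominated_kernel_shift HD0 (e1 h j h01).
  have k3 := dominated_kernelZ (- 2) HD0.
  have k4 := dominated_kernelZ (- h ^+ 2) HD2.
  have k5 j := dominated_kernelD (dominated_kernelD (k1 j) (k2 j)) k3.
  have k5e j : exists C5, dominated_kernel C5 (fun z =>
      moll b (z - h *: delta_mx ord0 j) + moll b (z + h *: delta_mx ord0 j) + - 2 * moll b z).
    by eexists; exact: k5.
  have [C6 k6] := dominated_kernel_sum k5e.
  transitivity (convol (fun z => \sum_j (moll b (z - h *: delta_mx ord0 j)
      + moll b (z + h *: delta_mx ord0 j)
      + - 2 * moll b z) + - h ^+ 2 * moll_lap b z) w x).
    apply: eq_Rintegral => y _; rewrite /lap_error; congr (_ * (_ + _)).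
      by apply: eq_bigr => j _; rewrite mulNr.
    by rewrite mulNr.
  rewrite (convolD _ wM k6 k4) (convol_sum _ wM k5e).
  rewrite (@convolZ R d _ _ _ _ (- h ^+ 2) x wM HD2) -VE mulNr; congr (_ - _).
  apply: eq_bigr => j _.
  rewrite (convolD _ wM (dominated_kernelD (k1 j) (k2 j)) k3) (convolD _ wM (k1 j) (k2 j)).
  rewrite (@convolZ R d _ _ _ _ (- 2) x wM HD0).
  rewrite mulNr.
  have W1 : W (x + h *: delta_mx ord0 j) = convol (fun y => moll b (y - h *: delta_mx ord0 j)) w x.
    by rewrite /W convol_shift.
  have W2 : W (x - h *: delta_mx ord0 j) = convol (fun y => moll b (y + h *: delta_mx ord0 j)) w x.
    by rewrite /W convol_shift; apply: eq_Rintegral => y _; rewrite opprK.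
  by rewrite W1 W2.
have DV h x : 0 <= h <= 1 -> `|D h x - h ^+ 2 * V x| <= M * (C * h ^+ 3) * m.
  by move=> h01; rewrite -DE//; exact: (convol_bound x wM (HC h h01)).
have M0 : 0 <= M by have [_ /(_ 0)] := wM; exact: le_trans.
have L0 : 0 <= L by have [_ /(_ 0)] := bBW; exact: le_trans.
have m0 : 0 <= m by exact: wint_ge0.
pose E h x : R := \sum_j (B (W (x + h *: delta_mx ord0 j))
  + B (W (x - h *: delta_mx ord0 j)) - 2 * B (W x)).
have DE_le h x : B' (W x) * D h x <= E h x.
  rewrite /D /E mulr_sumr; apply: ler_sum => j _.
  move: (W (x + h *: delta_mx ord0 j)) (W (x - h *: delta_mx ord0 j)) (W x) => s t v.
  have c1 := Bc v s; have c2 := Bc v t.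
  rewrite (_ : B' v * _ = B' v * (s - v) + B' v * (t - v)); last by ring.
  by lra.
have bs z := bounded_by_shift z bBW.
have b2 := bounded_byM (@bounded_by_cst R d 2) bBW.
have bE1 h j := bounded_byB (bounded_byD (bs (h *: delta_mx ord0 j))
  (bs (- (h *: delta_mx ord0 j)))) b2.
have bE h : bounded_by (d%:R * (L + L + `|2| * L)) (E h) := bounded_by_sum (bE1 h).
have wE h : 0 <= h <= 1 -> a * h <= 2^-1 ->
    wint a (E h) <= d%:R * (4 * (a * h) ^+ 2 * wint a (B \o W)).
  move=> /andP[h0 h1] ah; rewrite /E (wint_sum a0 (bE1 h)).
  rewrite (@le_trans _ _ (\sum_(j < d) (4 * (a * h) ^+ 2 * wint a (B \o W))))//; last first.
    by rewrite sumr_const card_ord -[leLHS]mulr_natl.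
  apply: ler_sum => j _.
  rewrite (wintB a0 (bounded_byD (bs (h *: delta_mx ord0 j)) (bs (- (h *: delta_mx ord0 j)))) b2).
  rewrite (wintD a0 (bs (h *: delta_mx ord0 j)) (bs (- (h *: delta_mx ord0 j)))) (wintZ a0 _ bBW).
  rewrite lerBlDr -mulrDl [_ + 2]addrC.
  exact: (wint_second_difference a0 j bBW (fun x => B0 (W x)) h0 ah h1).
(* Second differences of the weight are controlled for h <= 1 and a h <= 1/2. *)
pose h1 := Num.min 1 (2 * a)^-1.
have h10 : 0 < h1 by rewrite lt_min ltr01 invr_gt0 mulr_gt0.
have bBV := bounded_byM bB'W bV.
rewrite -subr_le0; apply: (@le0_of_linear_bound _
  (L * M * C * m * wint a (fun _ : 'rV[R]_d => 1)) h1) => // h.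
move=> /andP[h0]; rewrite le_min => /andP[h_1 ha].
have h01 : 0 <= h <= 1 by rewrite (ltW h0).
have ah : a * h <= 2^-1.
  by rewrite mulrC -ler_pdivlMr// (le_trans ha)// invfM.
have h2 : 0 < h ^+ 2 by rewrite exprn_gt0.
rewrite -(ler_pM2l h2) mulrBr.
pose K := L * (M * (C * h ^+ 3) * m).
have bK := @bounded_by_cst R d K.
have bh := bounded_byM (@bounded_by_cst R d (h ^+ 2)) bBV.
have key : h ^+ 2 * wint a (fun x => B' (W x) * V x) <=
    wint a (E h) + wint a (fun _ : 'rV[R]_d => K).
  rewrite -(wintZ a0 _ bBV) -(wintD a0 (bE h) bK).
  apply: (le_wint a0 bh (bounded_byD (bE h) bK)) => x.
  have [_ /(_ x) /= Bx] := bB'W.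
  have d1 := DV h x h01; have d2 := DE_le h x.
  have d3 : `|B' (W x) * (D h x - h ^+ 2 * V x)| <= K by rewrite normrM ler_pM.
  move: d3; rewrite ler_norml mulrBr => /andP[d3 _].
  rewrite -[leLHS]/(h ^+ 2 * (B' (W x) * V x)) -[leRHS]/(E h x + K).
  rewrite mulrCA; move: (B' (W x) * _) (B' (W x) * _) (E h x) d2 d3 => t1 t2 t3 d2 d3.
  by lra.
have wK : wint a (fun _ : 'rV[R]_d => K) = K * wint a (fun _ : 'rV[R]_d => 1).
  rewrite -(wintZ a0 _ (@bounded_by_cst R d 1)); congr wint.
  by apply/funext => x; rewrite mulr1.
have := wE h h01 ah; move: key; rewrite wK /K -/(B \o W).
move: (wint a (E h)) (wint a (B \o W)) (wint a (fun x => B' (W x) * V x))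
  (wint a (fun=> 1)) => p s t u.
rewrite exprMn => h3 h4.
have -> : h ^+ 2 * (L * M * C * m * u * h) = L * (M * (C * h ^+ 3) * m) * u by ring.
have -> : h ^+ 2 * (4 * d%:R * a ^+ 2 * s) = d%:R * (4 * (a ^+ 2 * h ^+ 2) * s) by ring.
lra.
Qed.

(** Removing the mollification: both sides change by at most a constant times the
    L^1(psi_a) distances of w and g to their mollifications. *)
Lemma kato (a M N L : R) (B B' : R -> R) w g :
  0 < a -> bounded_by M w -> bounded_by N g -> weak_laplacian w g ->
  convex_entropy M L B B' ->
  wint a (fun x => B' (w x) * g x) <= 4 * d%:R * a ^+ 2 * wint a (B \o w).
Proof.
move=> a0 wM gN wg adm; have [B0 Bc mB mB' BL B'L Blip B'lip] := adm.
have bBw := bounded_by_comp mB BL wM; have bB'w := bounded_by_comp mB' B'L wM.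
have L0 : 0 <= L by have [_ /(_ 0)] := bBw; exact: le_trans.
have N0 : 0 <= N by have [_ /(_ 0)] := gN; exact: le_trans.
rewrite -subr_le0.
set c := 4 * d%:R * a ^+ 2; have c0 : 0 <= c by rewrite mulr_ge0 ?sqr_ge0// mulr_ge0.
apply: (@le0_of_linear_bound _ (L * N + L + c * L) 1) => // e /andP[e0 _].
have [r1 r10 osc1] := oscillation_bounded a0 wM e0.
have [r2 r20 osc2] := oscillation_bounded a0 gN e0.
pose r := Num.min r1 r2.
have r0 : 0 < r by rewrite lt_min r10.
have oscw z : (forall i, `|z ord0 i| <= r) -> oscillation a w z <= e.
  by move=> zr; apply: osc1 => i; have := zr i; rewrite le_min => /andP[].
have oscg z : (forall i, `|z ord0 i| <= r) -> oscillation a g z <= e.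
  by move=> zr; apply: osc2 => i; have := zr i; rewrite le_min => /andP[].
have [b [tb bout b0 bint]] := mollifier_exists r0.
have H := mollified_kato a0 wM gN wg adm r0 tb bout b0 bint.
have dW := convol_approx r0 tb bout b0 bint a0 wM oscw.
have dV := convol_approx r0 tb bout b0 bint a0 gN oscg.
have bW := bounded_by_convol r0 tb bout b0 bint wM.
have bV := bounded_by_convol r0 tb bout b0 bint gN.
move: H dW dV bW bV; set W := convol (moll b) w; set V := convol (moll b) g.
move=> H dW dV bW bV.
have bBW := bounded_by_comp mB BL bW; have bB'W := bounded_by_comp mB' B'L bW.
have bdW := bounded_by_norm (bounded_byB bW wM).
have bdV := bounded_by_norm (bounded_byB bV gN).
have cLN := bounded_byM (@bounded_by_cst R d (L * N)) bdW.
have cLV := bounded_byM (@bounded_by_cst R d L) bdV.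
have cLW := bounded_byM (@bounded_by_cst R d L) bdW.
have bl := bounded_byM bB'w gN; have br := bounded_byM bB'W bV.
have h1 : wint a (fun x => B' (w x) * g x) <= wint a (fun x => B' (W x) * V x) +
    (L * N * wint a (fun x => `|W x - w x|) + L * wint a (fun x => `|V x - g x|)).
  rewrite -(wintZ a0 _ bdW) -(wintZ a0 _ bdV) -(wintD a0 cLN cLV).
  rewrite -(wintD a0 br (bounded_byD cLN cLV)).
  apply: (le_wint a0 bl (bounded_byD br (bounded_byD cLN cLV))) => x /=.
  have [_ /(_ x) Wx] := bW; have [_ /(_ x) wx] := wM.
  have [_ /(_ x) Vx] := bV; have [_ /(_ x) /= B'x] := bB'w.
  have l1 : `|(B' (W x) - B' (w x)) * V x| <= L * N * `|W x - w x|.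
    rewrite normrM mulrAC ler_pM//; exact: B'lip.
  have l2 : `|B' (w x) * (V x - g x)| <= L * `|V x - g x|.
    by rewrite normrM ler_wpM2r.
  move: l1 l2; rewrite !ler_norml mulrBl mulrBr => /andP[l1 _] /andP[l2 _].
 lra.
have h2 : wint a (fun x => B (W x)) <= wint a (B \o w) + L * wint a (fun x => `|W x - w x|).
  rewrite -(wintZ a0 _ bdW) -(wintD a0 bBw cLW).
  apply: (le_wint a0 bBW (bounded_byD bBw cLW)) => x /=.
  have [_ /(_ x) Wx] := bW; have [_ /(_ x) wx] := wM.
  by have := Blip _ _ Wx wx; rewrite ler_norml => /andP[_]; lra.
have h3 : L * N * wint a (fun x => `|W x - w x|) <= L * N * e by rewrite ler_wpM2l ?mulr_ge0.
have h4 : L * wint a (fun x => `|V x - g x|) <= L * e by rewrite ler_wpM2l.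
have h5 : L * wint a (fun x => `|W x - w x|) <= L * e by rewrite ler_wpM2l.
have h6 : c * wint a (fun x => B (W x)) <= c * (wint a (B \o w) + L * e).
  by rewrite ler_wpM2l// (le_trans h2)// lerD2l.
rewrite !mulrDl mulrDr in h6 *.
move: H; rewrite -/c; lra.
Qed.

End kato.

(** * The two convex functions *)

Section convex_functions.
Context {R : realType}.

Lemma convex_entropy_square (M : R) : 0 <= M ->
  convex_entropy M (M ^+ 2 + 2 * M + 2) (fun s => s ^+ 2) (fun s => 2 * s).
Proof.
move=> M0.
have M2 : 0 <= M ^+ 2 by exact: sqr_ge0.
have sq (s : R) : `|s| <= M -> `|s| ^+ 2 <= M ^+ 2 by move=> sM; rewrite lerXn2r ?nnegrE.
split.
- by move=> s; exact: sqr_ge0.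
- by move=> s t; have := sqr_ge0 (t - s); rewrite sqrrB; lra.
- exact: measurable_funX.
- exact: measurable_funM.
- by move=> s sM; rewrite normrX; have := sq _ sM; lra.
- by move=> s sM; rewrite normrM ger0_norm//; lra.
- move=> s t sM tM; rewrite subr_sqr mulrC normrM ler_wpM2r//.
  by rewrite (le_trans (ler_normD _ _))//; lra.
- by move=> s t _ _; rewrite -mulrBr normrM ler_wpM2r// ger0_norm//; lra.
Qed.

Lemma minr0_lip (s t : R) : `|Num.min s 0 - Num.min t 0| <= `|s - t|.
Proof.
rewrite !minEle.
by case: ifPn; case: ifPn; rewrite -?ltNge => h1 h2; rewrite ?subrr ?normr0 ?subr0 ?sub0r ?normrN//;
  rewrite ler_norml; apply/andP; split; rewrite ?(ler0_norm h1) ?(ler0_norm h2)//;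
  have := ler_norm (s - t); have := ler_norm (- (s - t)); rewrite normrN; lra.
Qed.

Lemma minr0_norm (s : R) : `|Num.min s 0| <= `|s|.
Proof. by have := minr0_lip s 0; rewrite minxx !subr0. Qed.

(** The constants are those of the square, because s -> min(s, 0) is a contraction
    fixing 0. *)
Lemma convex_entropy_neg_square (M : R) : 0 <= M ->
  convex_entropy M (M ^+ 2 + 2 * M + 2) (fun s => Num.min s 0 ^+ 2) (fun s => 2 * Num.min s 0).
Proof.
move=> M0; have [H1 H2 H3 H4 H5 H6 H7 H8] := convex_entropy_square M0.
have mm : measurable_fun setT (fun s : R => Num.min s 0).
  by apply: measurable_minr.
have nM s : `|s| <= M -> `|Num.min s 0| <= M by exact/le_trans/minr0_norm.
have L0 : 0 <= M ^+ 2 + 2 * M + 2 by have := sqr_ge0 M; lra.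
split.
- by move=> s; exact: sqr_ge0.
- move=> s t.
  have s1 : Num.min s 0 * s = Num.min s 0 ^+ 2.
    by rewrite minEle; case: ifPn; rewrite ?mul0r// expr0n.
  have s0 : Num.min s 0 <= 0 by rewrite ge_min lexx orbT.
  have t1 : Num.min t 0 <= t by rewrite ge_min lexx.
  have := sqr_ge0 (Num.min t 0 - Num.min s 0); nra.
- exact: measurable_funX.
- exact: measurable_funM.
- by move=> s /nM; exact: H5.
- by move=> s /nM; exact: H6.
- move=> s t /nM sM /nM tM; apply: (le_trans (H7 _ _ sM tM)).
  by rewrite ler_wpM2l// minr0_lip.
- move=> s t /nM sM /nM tM; apply: (le_trans (H8 _ _ sM tM)).
  by rewrite ler_wpM2l// minr0_lip.
Qed.

End convex_functions.

(** * The resolvent equation *)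

Section weak_maximum_principle.
Context {R : realType} {d : nat}.
Local Notation mu := (lebesgue_rV R d).
Implicit Types (w q f g : 'rV[R]_d -> R) (x y z : 'rV[R]_d).

Lemma weightE (a : R) x : weight a x = expR (- (a * \sum_i `|x ord0 i|)).
Proof. by rewrite /weight /prod_coord /exp_decay -expR_sum mulr_sumr sumrN. Qed.

Lemma weight_anti (a a' : R) x : a' <= a -> weight a x <= weight a' x.
Proof.
move=> aa; rewrite !weightE ler_expR lerN2 ler_wpM2r//.
by apply: sumr_ge0.
Qed.

Lemma weight_cvg1 x : weight (n.+1%:R^-1 : R) x @[n --> \oo] --> (1 : R).
Proof.
set S := \sum_i `|x ord0 i|.
have h : - (n.+1%:R^-1 * S) @[n --> \oo] --> (0 : R).
  rewrite -[X in _ --> X]oppr0 -(mul0r S); apply: cvgN; apply: cvgM.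
    exact: cvg_harmonic.
  exact: cvg_cst.
rewrite (_ : (fun n => _) = (fun n => expR (- (n.+1%:R^-1 * S)))).
  rewrite -[X in _ --> X]expR0.
  by apply: (continuous_cvg _ _ h); exact: continuous_expR.
by apply/funext => n; rewrite weightE.
Qed.

Variables (kap M N K : R) (w' w c : 'rV[R]_d -> R).
Hypotheses (kap_gt0 : 0 < kap) (w'M : bounded_by M w') (wN : bounded_by N w)
  (cK : bounded_by K c) (c_ge0 : forall x, 0 <= c x)
  (eqn : weak_laplacian w' (fun x => kap^-1 * ((1 + c x) * w' x - w x))).

Let M_ge0 : 0 <= M. Proof. by have [_ /(_ 0)] := w'M; exact: le_trans. Qed.

Let gB := bounded_byM (@bounded_by_cst R d kap^-1)
  (bounded_byB (bounded_byM (bounded_byD (@bounded_by_cst R d 1) cK) w'M) wN).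

(** Since min(w', 0) w' = min(w', 0)^2 while c >= 0 and w >= 0, the left-hand side
    of the Kato inequality is at least 2 / kap times the integral of
    min(w', 0)^2 psi_a. For small a this exceeds the right-hand side unless both
    vanish. *)
Lemma weak_nonneg : (forall x, 0 <= w x) -> \forall x \ae mu, 0 <= w' x.
Proof.
move=> w0.
pose D := 4 * d%:R * kap.
have D0 : 0 <= D by rewrite /D mulr_ge0 ?(ltW kap_gt0)// mulr_ge0.
(* Any a with D a^2 <= 1 works; this one satisfies it because D a <= 1 and a <= 1. *)
pose a := (D + 1)^-1.
have a0 : 0 < a by rewrite invr_gt0 ltr_wpDl.
have Da : D * a ^+ 2 <= 1.
  have aD : a * (D + 1) = 1 by rewrite mulVf// gt_eqF// ltr_wpDl.
  have a1 : a <= 1 by rewrite invf_le1 ?lerDr// ltr_wpDl.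
  nra.
have adm := convex_entropy_neg_square M_ge0.
have := kato a0 w'M gB eqn adm.
have [B0 _ mB mB' BL B'L _ _] := adm.
have bB := bounded_by_comp mB BL w'M; have bB' := bounded_by_comp mB' B'L w'M.
set B := fun s : R => Num.min s 0 ^+ 2 in bB B0 *.
set I := wint a (B \o w').
have b2B := bounded_byM (@bounded_by_cst R d (2 * kap^-1)) bB.
have H : 2 * kap^-1 * I <=
    wint a (fun x => 2 * Num.min (w' x) 0 * (kap^-1 * ((1 + c x) * w' x - w x))).
  rewrite -(wintZ a0 _ bB); apply: (le_wint a0 b2B (bounded_byM bB' gB)) => x.
  rewrite -[leLHS]/(2 * kap^-1 * Num.min (w' x) 0 ^+ 2).
  rewrite -[leRHS]/(2 * Num.min (w' x) 0 * (kap^-1 * ((1 + c x) * w' x - w x))).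
  have s1 : Num.min (w' x) 0 * w' x = Num.min (w' x) 0 ^+ 2.
    by rewrite minEle; case: ifPn; rewrite ?mul0r// expr0n.
  have s0 : Num.min (w' x) 0 <= 0 by rewrite ge_min lexx orbT.
  have -> : 2 * Num.min (w' x) 0 * (kap^-1 * ((1 + c x) * w' x - w x)) =
      2 * kap^-1 * ((1 + c x) * (Num.min (w' x) 0 * w' x) - Num.min (w' x) 0 * w x).
    by move: (w x) (c x) (w' x) (Num.min (w' x) 0) => m0 m1 m2 m3; ring.
  rewrite ler_wpM2l ?mulr_ge0 ?invr_ge0 ?(ltW kap_gt0)// s1.
  have := w0 x; have := c_ge0 x; move: (Num.min _ 0) s0 (c x) (w x) => m m0 p q p0 q0.
  have := sqr_ge0 m; nra.
have I0 : 0 <= I by apply: wint_ge0 => x; exact: B0.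
move=> /(le_trans H) H1.
have I_eq0 : I = 0.
  apply/eqP; rewrite eq_le I0 andbT.
  have : kap * (2 * kap^-1 * I) <= kap * (4 * d%:R * a ^+ 2 * I) by rewrite ler_pM2l.
  rewrite (_ : kap * (2 * kap^-1 * I) = 2 * I); last by field; rewrite gt_eqF.
  rewrite (_ : kap * (4 * d%:R * a ^+ 2 * I) = D * a ^+ 2 * I); last by rewrite /D; ring.
  have : D * a ^+ 2 * I <= I by rewrite ler_piMl.
  lra.
have iB := integrable_weight a0 bB.
have : (\int[mu]_x `|(B (w' x) * weight a x)%:E| = 0)%E.
  rewrite (eq_integral (fun x => (B (w' x) * weight a x)%:E)); last first.
    move=> x _; rewrite gee0_abs// lee_fin mulr_ge0 ?weight_ge0//; exact: B0.
  rewrite -[LHS](@fineK _ (\int[mu]_x _)%E); last exact: (integrable_fin_num measurableT iB).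
  by rewrite -[fine _]/I I_eq0.
have /integrableP[miB _] := iB.
move=> /(ae_eq_integral_abs mu measurableT miB).
apply: filterS => x /(_ Logic.I) /eqP; rewrite eqe mulf_eq0 (gt_eqF (weight_gt0 _ _)) orbF.
rewrite expf_eq0/= => /eqP m0.
by rewrite -m0 ge_min lexx.
Qed.

(** Here 2 w' ((1 + c) w' - w) >= w'^2 - w^2. The weighted integral of w'^2 is finite
    but a priori unbounded as a tends to 0; the Kato inequality bounds it by the
    integral of w^2 up to a factor 1 - 4 d kap a^2, and it grows as a decreases. *)
Lemma weak_contraction : (\int[mu]_x (w' x ^+ 2)%:E <= \int[mu]_x (w x ^+ 2)%:E)%E.
Proof.
have [->|Ifin] := eqVneq (\int[mu]_x (w x ^+ 2)%:E)%E +oo%E; first by rewrite leey.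
have [mw' _] := w'M; have [mw _] := wN.
have mEw' : measurable_fun setT (fun x => (w' x ^+ 2)%:E).
  by apply/measurable_EFinP; exact: measurable_funX.
have mEw : measurable_fun setT (fun x => (w x ^+ 2)%:E).
  by apply/measurable_EFinP; exact: measurable_funX.
set I := fine (\int[mu]_x (w x ^+ 2)%:E)%E.
have IE : (\int[mu]_x (w x ^+ 2)%:E = I%:E)%E.
  rewrite fineK// ge0_fin_numE ?ltey//.
  by apply: integral_ge0 => x _; rewrite lee_fin sqr_ge0.
have adm := convex_entropy_square M_ge0.
have [_ _ mB mB' BL B'L _ _] := adm.
have bB := bounded_by_comp mB BL w'M; have bB' := bounded_by_comp mB' B'L w'M.
have [_ _ mBw _ BwL _ _ _] := convex_entropy_square (le_trans (normr_ge0 _) (wN.2 0)).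
have bw2 := bounded_by_comp mBw BwL wN.
pose J a := wint a (fun x => w' x ^+ 2).
have HJ a : 0 < a -> J a - I <= kap * 4 * d%:R * a ^+ 2 * J a.
  move=> a0.
  have := kato a0 w'M gB eqn adm; rewrite -[wint a (_ \o _)]/(J a) => H1.
  have bd := bounded_byB bB bw2.
  have bk := bounded_byM (@bounded_by_cst R d kap^-1) bd.
  have H2 : kap^-1 * (J a - wint a (fun x => w x ^+ 2)) <=
      wint a (fun x => 2 * w' x * (kap^-1 * ((1 + c x) * w' x - w x))).
    rewrite -(wintB a0 bB bw2) -(wintZ a0 _ bd).
    apply: (le_wint a0 bk (bounded_byM bB' gB)) => x.
    rewrite -[leLHS]/(kap^-1 * (w' x ^+ 2 - w x ^+ 2)).
    rewrite -[leRHS]/(2 * w' x * (kap^-1 * ((1 + c x) * w' x - w x))) mulrCA.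
    rewrite ler_pM2l ?invr_gt0//.
    have := c_ge0 x; move: (w' x) (c x) (w x) => m p q p0.
    have := sqr_ge0 m; have := sqr_ge0 (m - q); nra.
  have H3 : wint a (fun x => w x ^+ 2) <= I.
    rewrite /I /wint /Rintegral fine_le//.
    - exact: (integrable_fin_num measurableT (integrable_weight a0 bw2)).
    - by rewrite IE.
    - apply: ge0_le_integral => //.
      + by move=> x _; rewrite lee_fin mulr_ge0 ?sqr_ge0 ?weight_ge0.
      + by have /integrableP[] := integrable_weight a0 bw2.
      + move=> x _; rewrite lee_fin ler_piMr ?sqr_ge0// weightE expR_le1 oppr_le0.
        by apply: mulr_ge0; [exact: ltW|exact: sumr_ge0].
  have : kap * (kap^-1 * (J a - wint a (fun x => w x ^+ 2))) <= kap * (4 * d%:R * a ^+ 2 * J a).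
    by rewrite ler_pM2l// (le_trans H2).
  rewrite mulVKf ?gt_eqF// (_ : kap * (_ * J a) = kap * 4 * d%:R * a ^+ 2 * J a); last by ring.
  lra.
have JI a : 0 < a -> J a <= I.
  move=> a0; rewrite -subr_le0.
  pose a1 := Num.min a 1.
  have a10 : 0 < a1 by rewrite lt_min a0 ltr01.
  have J0 h : 0 <= J h by apply: wint_ge0 => x; exact: sqr_ge0.
  have Jmono h : 0 < h <= a -> J a <= J h.
    move=> /andP[h0 ha]; apply: le_Rintegral => //.
    - exact: integrable_weight bB.
    - exact: integrable_weight bB.
    - by move=> x _; rewrite ler_wpM2l ?sqr_ge0// weight_anti.
  pose Q := kap * 4 * d%:R.
  have Q0 : 0 <= Q by rewrite mulr_ge0// mulr_ge0// ltW.
  (* Once Q h <= 1/2, J h <= 2 I, so that the error becomes linear in h. *)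
  pose h1 := Num.min a1 (2 * (Q + 1))^-1.
  have h10 : 0 < h1 by rewrite lt_min a10 invr_gt0 mulr_gt0// ltr_wpDl.
  apply: (le0_of_linear_bound (C := Q * (2 * I)) h10) => h.
  move=> /andP[h0]; rewrite !le_min => /andP[/andP[ha hle1] hQ].
  have Qh : Q * h <= 2^-1.
    have : h * (2 * (Q + 1)) <= 1 by rewrite -ler_pdivlMr ?mulr_gt0 ?ltr_wpDl// div1r.
    nra.
  have Jah : J a <= J h by apply: Jmono; rewrite h0.
  move: (HJ h h0) Jah (J0 h); rewrite -/Q; move: (J h) (J a) (I) => j ja i Jh Jah j0.
  have e2 : Q * h ^+ 2 * j <= Q * h * j.
    by rewrite ler_wpM2r// ler_wpM2l// expr2 ler_piMr// ltW.
  have e3 : Q * h * j <= 2^-1 * j by rewrite ler_wpM2r.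
  have e4 : j <= 2 * i by lra.
  have e5 : Q * h * j <= Q * h * (2 * i) by rewrite ler_wpM2l// mulr_ge0// ltW.
  by rewrite (mulrAC Q (2 * i) h); lra.
pose g n x := (w' x ^+ 2 * weight (n.+1%:R^-1) x)%:E.
have g0 n x : (0 <= g n x)%E by rewrite lee_fin mulr_ge0 ?sqr_ge0 ?weight_ge0.
have mg n : measurable_fun setT (g n).
  apply/measurable_EFinP; apply: measurable_funM; last exact: measurable_weight.
  exact: measurable_funX.
have ndg x : nondecreasing_seq (g ^~ x).
  move=> n m nm; rewrite lee_fin ler_wpM2l ?sqr_ge0// weight_anti//.
  by rewrite lef_pV2 ?posrE// ler_nat.
have gl x : limn (g ^~ x) = (w' x ^+ 2)%:E.
  apply/cvg_lim => //; apply: cvg_EFin.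
    by apply: nearW => n.
  rewrite -[X in _ --> X]mulr1; apply: cvgM; first exact: cvg_cst.
  exact: weight_cvg1.
have -> : (\int[mu]_x (w' x ^+ 2)%:E = \int[mu]_x limn (g ^~ x))%E.
  by apply: eq_integral => x _; rewrite gl.
rewrite (@monotone_convergence _ _ _ mu _ measurableT g)//.
rewrite IE; apply: lime_le.
  by apply: ereal_nondecreasing_is_cvgn => n m nm; apply: ge0_le_integral => // x _; exact: ndg.
apply: nearW => n.
have n0 : 0 < n.+1%:R^-1 :> R by rewrite invr_gt0.
rewrite -[leLHS](@fineK _ (\int[mu]_x _)%E).
  by rewrite lee_fin; exact: JI.
exact: (integrable_fin_num measurableT (integrable_weight n0 bB)).
Qed.

End weak_maximum_principle.

(** * One elliptic step of the scheme *)

Section elliptic_step.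
Context {R : realType} {d : nat}.
Local Notation mu := (lebesgue_rV R d).
Implicit Types (w q f g : 'rV[R]_d -> R) (x y z : 'rV[R]_d).

Definition ae_bounded f : Prop :=
  measurable_fun setT f /\ exists M, \forall x \ae mu, `|f x| <= M.

(** The supremum norm is 0 by convention when the whole space is negligible; in
    that case every bound holds almost everywhere. *)
Lemma bounded_measurable_ae f : bounded_measurable f -> ae_bounded f.
Proof.
move=> /andP[]; rewrite !inE /= /finite_norm => mf; rewrite unlock.
case: ifPn => [_ foo|].
  split => //.
  have [M HM] := @ess_supr_bounded _ _ _ mu (fun x => `|f x|) foo.
  by exists M.
rewrite -leNgt => mu0 _; split => //; exists 0.
exists setT; split => //.
by apply/eqP; rewrite eq_le mu0 measure_ge0.
Qed.

Lemma ae_boundedD f g : ae_bounded f -> ae_bounded g -> ae_bounded (fun x => f x + g x).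
Proof.
move=> [mf [M fM]] [mg [N gN]]; split; first exact: measurable_funD.
exists (M + N); apply: filterS2 fM gN => x fx gx.
by rewrite (le_trans (ler_normD _ _))// lerD.
Qed.

Lemma ae_boundedM f g : ae_bounded f -> ae_bounded g -> ae_bounded (fun x => f x * g x).
Proof.
move=> [mf [M fM]] [mg [N gN]]; split; first exact: measurable_funM.
exists (M * N); apply: filterS2 fM gN => x fx gx.
by rewrite normrM ler_pM.
Qed.

Lemma ae_bounded_cst (c : R) : ae_bounded (fun=> c).
Proof. by split; [exact: measurable_cst|exists `|c|; exact: nearW]. Qed.

Lemma ae_boundedB f g : ae_bounded f -> ae_bounded g -> ae_bounded (fun x => f x - g x).
Proof.
move=> bf bg; have := ae_boundedD bf (ae_boundedM (ae_bounded_cst (-1)) bg).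
by congr ae_bounded; apply/funext => x; rewrite mulN1r.
Qed.

(** Truncation at the levels -M and M, or 0 and M, gives representatives that
    satisfy the bounds everywhere. *)
Lemma ae_bounded_clamp f : ae_bounded f -> exists M f',
  [/\ bounded_by M f', \forall x \ae mu, f x = f' x &
      (\forall x \ae mu, 0 <= f x) -> exists N f'',
      [/\ bounded_by N f'', \forall x \ae mu, f x = f'' x & forall x, 0 <= f'' x]].
Proof.
move=> [mf [M0 fM0]].
pose M := Num.max M0 0.
have M_ge0 : 0 <= M by rewrite le_max lexx orbT.
have fM : \forall x \ae mu, `|f x| <= M by apply: filterS fM0 => x fx; rewrite le_max fx.
pose clamp (lo : R) x := Num.max lo (Num.min (f x) M).
have mc lo : measurable_fun setT (clamp lo).
  by apply: measurable_maxr => //; exact: measurable_minr.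
have bc lo : - M <= lo <= 0 -> bounded_by M (clamp lo).
  move=> /andP[lo1 lo2]; split => // x; rewrite ler_norml; apply/andP; split.
    by rewrite le_max lo1.
  by rewrite ge_max (le_trans lo2)//= ge_min lexx orbT.
exists M, (clamp (- M)); split; first by apply: bc; rewrite lexx oppr_le0.
  apply: filterS fM => x; rewrite ler_norml => /andP[f1 f2].
  by rewrite /clamp (min_l f2) (max_r f1).
move=> f0; exists M, (clamp 0); split; first by apply: bc; rewrite lexx oppr_le0 M_ge0.
  apply: filterS2 fM f0 => x; rewrite ler_norml => /andP[f1 f2] f3.
  by rewrite /clamp (min_l f2) (max_r f3).
by move=> x; rewrite le_max lexx.
Qed.

Lemma ae_eq_Rintegral f g : measurable_fun setT f -> measurable_fun setT g ->
  (\forall x \ae mu, f x = g x) -> \int[mu]_x f x = \int[mu]_x g x.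
Proof.
move=> mf mg fg; rewrite /Rintegral; congr fine; apply: ae_eq_integral => //.
- exact/measurable_EFinP.
- exact/measurable_EFinP.
- by apply: filterS fg => x -> _.
Qed.

Lemma integrable_bounded_mul M q f : bounded_by M q ->
  mu.-integrable setT (EFin \o f) -> mu.-integrable setT (EFin \o (fun x => q x * f x)).
Proof.
move=> [mq qM] fi; have /integrableP[mf _] := fi.
have M0 : 0 <= M by exact: le_trans (qM 0).
have mf' : measurable_fun setT f by exact/measurable_EFinP.
apply: (le_integrable measurableT _ _ (integrableZl measurableT M fi)).
  by apply/measurable_EFinP; exact: measurable_funM.
move=> x _; rewrite /= lee_fin !normrM ler_wpM2r//.
by rewrite (le_trans (qM x))// ler_norm.
Qed.

(** Solve the equation for Laplacian w'. The integrals do not change when the data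
    are replaced by their everywhere bounded representatives. *)
Lemma elliptic_weak_laplacian (tau D eps M N K : R) w w' C v0 v c :
  0 < tau -> 0 < D -> 0 < eps ->
  ae_bounded w -> ae_bounded w' -> ae_bounded C ->
  elliptic_step tau D w w' (fun x => - eps^-1 * w' x * C x) ->
  bounded_by M v -> bounded_by N v0 -> bounded_by K c ->
  (\forall x \ae mu, w' x = v x) -> (\forall x \ae mu, w x = v0 x) ->
  (\forall x \ae mu, C x = c x) ->
  weak_laplacian v (fun x => (tau * D)^-1 * ((1 + tau / eps * c x) * v x - v0 x)).
Proof.
move=> tau0 D0 eps0 [mw _] [mw' _] [mC _] step bv bv0 bc ev ev0 ec phi tphi iphi ilap.
have [mv _] := bv; have [mv0 _] := bv0; have [mc _] := bc.
have mphi : measurable_fun setT phi.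
  by have /integrableP[m _] := iphi; exact/measurable_EFinP.
have mlap : measurable_fun setT (laplacian phi).
  by have /integrableP[m _] := ilap; exact/measurable_EFinP.
have := step phi tphi; rewrite /distr_laplacian /distr_of.
rewrite (@ae_eq_Rintegral (fun x => (w' x - w x) / tau * phi x)
    (fun x => tau^-1 * ((v x - v0 x) * phi x))); last 3 first.
- apply: measurable_funM => //; apply: measurable_funM => //.
  exact: measurable_funB.
- apply: measurable_funM => //; apply: measurable_funM => //.
  exact: measurable_funB.
- by apply: filterS2 ev ev0 => x -> ->; rewrite mulrAC mulrC.
rewrite (@ae_eq_Rintegral (fun x => w' x * laplacian phi x)
    (fun x => v x * laplacian phi x)); last 3 first.
- exact: measurable_funM.
- exact: measurable_funM.
- by apply: filterS ev => x ->.
rewrite (@ae_eq_Rintegral (fun x => - eps^-1 * w' x * C x * phi x)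
    (fun x => - eps^-1 * (v x * c x * phi x))); last 3 first.
- by apply: measurable_funM => //; apply: measurable_funM => //; exact: measurable_funM.
- by apply: measurable_funM => //; apply: measurable_funM => //; exact: measurable_funM.
- by apply: filterS2 ev ec => x -> ->; rewrite !mulrA.
have i1 := integrable_bounded_mul (bounded_byB bv bv0) iphi.
have i2 := integrable_bounded_mul (bounded_byM bv bc) iphi.
rewrite !RintegralZl// => H.
rewrite [RHS](_ : _ = \int[mu]_x ((tau * D)^-1 * ((v x - v0 x) * phi x) +
    (D * eps)^-1 * (v x * c x * phi x))); last first.
  apply: eq_Rintegral => x _.
  by move: (v x) (v0 x) (c x) (phi x) => s1 s2 s3 s4; field; rewrite !gt_eqF.
have j1 : mu.-integrable setT (EFin \o (fun x => (tau * D)^-1 * ((v x - v0 x) * phi x))).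
  exact: (integrable_bounded_mul (bounded_by_cst _) i1).
have j2 : mu.-integrable setT (EFin \o (fun x => (D * eps)^-1 * (v x * c x * phi x))).
  exact: (integrable_bounded_mul (bounded_by_cst _) i2).
rewrite (RintegralD measurableT j1 j2) !RintegralZl//.
move: H; move: (Rintegral _ _ _) (Rintegral _ _ _) (Rintegral _ _ _) => p q s H.
have Dq : D * q = tau^-1 * s + eps^-1 * p by lra.
apply: (mulfI (x := D)); first by rewrite gt_eqF.
by rewrite Dq; field; rewrite !gt_eqF.
Qed.

Lemma L2_normE f : L2_norm f = ((\int[mu]_x (f x ^+ 2)%:E) `^ 2^-1)%E.
Proof.
rewrite /L2_norm unlock; congr (_ `^ _)%E; apply: eq_integral => x _.
by rewrite /= powR_mulrn// real_normK// num_real.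
Qed.

Lemma le_L2_norm f g : (\int[mu]_x (f x ^+ 2)%:E <= \int[mu]_x (g x ^+ 2)%:E)%E ->
  (L2_norm f <= L2_norm g)%E.
Proof.
move=> fg; rewrite !L2_normE; apply: gt0_ler_poweR => //.
- by rewrite in_itv/= leey andbT integral_ge0// => x _; rewrite lee_fin sqr_ge0.
- by rewrite in_itv/= leey andbT integral_ge0// => x _; rewrite lee_fin sqr_ge0.
Qed.

Lemma in_L2_le f g : measurable_fun setT f -> (L2_norm f <= L2_norm g)%E ->
  in_L2 g -> in_L2 f.
Proof.
move=> mf fg /andP[_]; rewrite !inE/= /finite_norm => goo.
apply/andP; rewrite !inE/= /finite_norm; split => //.
exact: le_lt_trans goo.
Qed.

Lemma elliptic_step_stable (tau D eps : R) w w' C :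
  0 < tau -> 0 < D -> 0 < eps ->
  ae_bounded w -> ae_bounded w' -> ae_bounded C ->
  elliptic_step tau D w w' (fun x => - eps^-1 * w' x * C x) ->
  (\forall x \ae mu, 0 <= C x) -> (\forall x \ae mu, 0 <= w x) ->
  (\forall x \ae mu, 0 <= w' x) /\ (L2_norm w' <= L2_norm w)%E.
Proof.
move=> tau0 D0 eps0 bw bw' bC step C0 w0.
have [M [v [bv ev _]]] := ae_bounded_clamp bw'.
have [_ [_ [_ _ /(_ w0) [N [v0 [bv0 ev0 v00]]]]]] := ae_bounded_clamp bw.
have [_ [_ [_ _ /(_ C0) [K [c [bc ec c0]]]]]] := ae_bounded_clamp bC.
have weak := elliptic_weak_laplacian tau0 D0 eps0 bw bw' bC step bv bv0 bc ev ev0 ec.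
have te : 0 <= tau / eps by rewrite divr_ge0// ltW.
have tD : 0 < tau * D by exact: mulr_gt0.
have btc := bounded_byM (@bounded_by_cst R d (tau / eps)) bc.
have tc0 x : 0 <= tau / eps * c x by exact: mulr_ge0.
split.
  apply: filterS2 ev (weak_nonneg tD bv bv0 btc tc0 weak v00) => x -> //.
apply: le_L2_norm; have [mw _] := bw; have [mw' _] := bw'.
have [mv _] := bv; have [mv0 _] := bv0.
rewrite (@ae_eq_integral _ _ _ mu setT
  (fun x => (v x ^+ 2)%:E) (fun x => (w' x ^+ 2)%:E))//; last 3 first.
- by apply/measurable_EFinP; exact: measurable_funX.
- by apply/measurable_EFinP; exact: measurable_funX.
- by apply: filterS ev => x -> _.
rewrite (@ae_eq_integral _ _ _ mu setT
  (fun x => (v0 x ^+ 2)%:E) (fun x => (w x ^+ 2)%:E))//; last 3 first.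
- by apply/measurable_EFinP; exact: measurable_funX.
- by apply/measurable_EFinP; exact: measurable_funX.
- by apply: filterS ev0 => x -> _.
exact: (weak_contraction tD bv bv0 btc tc0 weak).
Qed.

End elliptic_step.

(** Clearing denominators, p' (eps + tau (u + v)) = eps p + tau u, so p' is the
    average of p, 1 and 0 with weights eps, tau u and tau v. *)
Lemma implicit_fraction_unit_interval (R : realFieldType) (eps tau u v p p' : R) :
  0 < eps -> 0 < tau -> 0 <= u -> 0 <= v -> 0 <= p <= 1 ->
  (p' - p) / tau = eps^-1 * ((1 - p') * u - v * p') -> 0 <= p' <= 1.
Proof.
move=> eps0 tau0 u0 v0 /andP[p0 p1] H.
have e : p' * (eps + tau * (u + v)) = eps * p + tau * u.
  have : eps * tau * ((p' - p) / tau) = eps * tau * (eps^-1 * ((1 - p') * u - v * p')) by rewrite H.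
  rewrite (_ : eps * tau * ((p' - p) / tau) = eps * (p' - p)); last by field; rewrite gt_eqF.
  rewrite (_ : eps * tau * (eps^-1 * _) = tau * ((1 - p') * u - v * p')); last by field; rewrite gt_eqF.
  lra.
have uv : 0 <= tau * (u + v) by rewrite mulr_ge0 ?addr_ge0// ltW.
have d0 : 0 < eps + tau * (u + v) by rewrite ltr_pwDl.
apply/andP; split.
  by rewrite -(pmulr_lge0 _ d0) e addr_ge0// mulr_ge0// ltW.
have ep : eps * p <= eps by rewrite ler_piMr// ltW.
have tv : 0 <= tau * v by rewrite mulr_ge0// ltW.
by rewrite -(ler_pM2r d0) e mul1r mulrDr; lra.
Qed.

Theorem lemma2p2 (R : realType) (d : nat) (hd : (0 < d)%N)
    (eps lam tau d1 d2 : R)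
    (heps : 0 < eps) (hlam : 0 < lam) (htau : 0 < tau)
    (hd1 : 0 < d1) (hd2 : 0 < d2)
    (u v p : nat -> 'rV[R]_d -> R)
    (hbounded : forall n : nat,
      [/\ bounded_measurable (u n), bounded_measurable (v n)
        & bounded_measurable (p n)])
    (hscheme : forall n : nat,
      scheme_step eps lam tau d1 d2 (u n) (v n) (p n)
        (u n.+1) (v n.+1) (p n.+1))
    (hu0 : nonneg_bounded (u 0%N)) (hv0 : nonneg_bounded (v 0%N))
    (hp0 : \forall x \ae lebesgue_rV R d, 0 <= p 0%N x <= 1)
    (hu0L2 : in_L2 (u 0%N)) (hv0L2 : in_L2 (v 0%N)) :
  forall n : nat,
    [/\ in_L2 (u n), in_L2 (v n),
        (L2_norm (u n.+1) <= L2_norm (u n))%E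
      & (L2_norm (v n.+1) <= L2_norm (v n))%E].
Proof.
pose inv n := [/\ \forall x \ae lebesgue_rV R d, 0 <= u n x,
    \forall x \ae lebesgue_rV R d, 0 <= v n x
  & \forall x \ae lebesgue_rV R d, 0 <= p n x <= 1].
have bu n : ae_bounded (u n) by have [/bounded_measurable_ae] := hbounded n.
have bv n : ae_bounded (v n) by have [_ /bounded_measurable_ae] := hbounded n.
have bp n : ae_bounded (p n) by have [_ _ /bounded_measurable_ae] := hbounded n.
have step n : inv n -> [/\ inv n.+1, (L2_norm (u n.+1) <= L2_norm (u n))%E
      & (L2_norm (v n.+1) <= L2_norm (v n))%E].
  move=> [u0 v0 p0]; have [hp hu hv] := hscheme n.
  have p0' : \forall x \ae lebesgue_rV R d, 0 <= p n.+1 x <= 1.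
    have uv : \forall x \ae lebesgue_rV R d, 0 <= u n x /\ 0 <= v n x.
      by apply: filterS2 u0 v0 => x ? ?; split.
    apply: filterS3 uv p0 hp => x [ux vx] px.
    exact: implicit_fraction_unit_interval.
  have bl := ae_bounded_cst (d := d) lam.
  have [u0' uL2] : (\forall x \ae lebesgue_rV R d, 0 <= u n.+1 x) /\
      (L2_norm (u n.+1) <= L2_norm (u n))%E.
    apply: (elliptic_step_stable htau hd1 heps (bu n) (bu n.+1) _ hu) => //.
      apply: ae_boundedD (bv n) (ae_boundedM bl _).
      exact: ae_boundedB (ae_bounded_cst 1) (bp n.+1).
    apply: filterS2 v0 p0' => x vx /andP[_ px].
    by rewrite addr_ge0// mulr_ge0 ?(ltW hlam)// subr_ge0.
  have [v0' vL2] : (\forall x \ae lebesgue_rV R d, 0 <= v n.+1 x) /\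
      (L2_norm (v n.+1) <= L2_norm (v n))%E.
    apply: (elliptic_step_stable htau hd2 heps (bv n) (bv n.+1) _ hv) => //.
      exact: ae_boundedD (bu n.+1) (ae_boundedM bl (bp n.+1)).
    apply: filterS2 u0' p0' => x ux /andP[px _].
    by rewrite addr_ge0// mulr_ge0 ?(ltW hlam).
  by split.
have I0 : inv 0%N.
  split => //.
  - by have [h _] := hu0; apply: filterS h => x /andP[]; rewrite lee_fin.
  - by have [h _] := hv0; apply: filterS h => x /andP[]; rewrite lee_fin.
have H n : [/\ inv n, in_L2 (u n) & in_L2 (v n)].
  elim: n => [//|n [In un vn]]; have [In1 uL vL] := step n In; split => //.
  - by apply: in_L2_le uL un; have [] := bu n.+1.
  - by apply: in_L2_le vL vn; have [] := bv n.+1.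
by move=> n; have [In un vn] := H n; have [_ uL vL] := step n In; split.
Qed.
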